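(* Let $\mathcal{E}$ be an evolution algebra over $\mathbb{F}$ with $\mathcal{E}^2=\mathcal{E}$ and natural basis $B=\{v_1,\ldots,v_n\}$. Let $\Gamma=\Gamma(\mathcal{E},B)$ be its associated graph. Then there is a subgroup $H$ of $\mathrm{Aut}(\Gamma)$ and a short exact sequence of affine group schemes $$1\longrightarrow\mathbf{Diag}(\Gamma)\stackrel{\iota}{\longrightarrow}\mathbf{Aut}(\mathcal{E})\stackrel{\rho}{\longrightarrow}\mathsf{H}\longrightarrow1,$$ where $\mathsf{H}$ is the constant group scheme associated to $H$.
   Context: $\mathbb{F}$ is a field of arbitrary characteristic; all algebras over $\mathbb{F}$ other than the coefficient algebras $R$ are finite dimensional. $\mathrm{Alg}_{\mathbb{F}}$ is the category of unital commutative associative $\mathbb{F}$-algebras; an affine group scheme is a representable functor $\mathrm{Alg}_{\mathbb{F}}\to\mathrm{Grp}$. Short exact means: the first map is a monomorphism whose image is the kernel of the second, and the second is a quotient map of affine group schemes (injective on representing Hopf algebras). An algebra is a vector space with a bilinear multiplication (not assumed associative, commutative or unital). An evolution algebra is an algebra $\mathcal{E}$ endowed with a basis $B=\{v_1,\ldots,v_n\}$ (a natural basis) such that $v_iv_j=0$ for all $i\neq j$. Write $v_i^2=\sum_{j=1}^n\alpha_{ij}v_j$ with $\alpha_{ij}\in\mathbb{F}$. $\mathcal{E}^2$ is the span of all products; $\mathcal{E}^2=\mathcal{E}$ is equivalent to $(\alpha_{ij})$ being invertible. The associated directed graph $\Gamma(\mathcal{E},B)=(V,E)$ has $V=B$ and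 $E=\{(v_i,v_j)\mid\alpha_{ij}\neq0\}\subseteq V\times V$. $\mathbf{Diag}(\Gamma)(R)=\{\varphi:V\to R^\times\mid\varphi(w)=\varphi(v)^2\ \text{for all}\ (v,w)\in E\}$, with pointwise multiplication. $\mathbf{Aut}(\mathcal{E})(R)=\mathrm{Aut}(\mathcal{E}_R)$ is the group of $R$-algebra automorphisms of $\mathcal{E}_R=\mathcal{E}\otimes_{\mathbb{F}}R$. $\mathrm{Aut}(\Gamma)=\{\sigma\in S_n\mid(v_i,v_j)\in E\Rightarrow(v_{\sigma(i)},v_{\sigma(j)})\in E\}$. For a finite group $G$, the constant group scheme $\mathsf{G}$ is represented by $\mathbb{F}^G=\mathrm{Maps}(G,\mathbb{F})$ with basis $\{\epsilon_g\}$, $\epsilon_g(h)=1$ if $h=g$ and $0$ otherwise, so $\mathsf{G}(R)=\mathrm{Hom}_{\mathrm{Alg}_{\mathbb{F}}}(\mathbb{F}^G,R)$; $\mathsf{Aut}(\Gamma)$ is the one attached to $\mathrm{Aut}(\Gamma)$, and for a subgroup $H\le\mathrm{Aut}(\Gamma)$, $\mathsf{H}$ is viewed as a subgroup scheme of $\mathsf{Aut}(\Gamma)$. The homomorphism $\iota$: for $\varphi\in\mathbf{Diag}(\Gamma)(R)$, $\iota_R(\varphi)=\hat\varphi$ is the automorphism of $\mathcal{E}_R$ with $\hat\varphi(v_i)=\varphi(v_i)v_i$ for all $i$. The homomorphism $\rho:\mathbf{Aut}(\mathcal{E})\to\mathsf{Aut}(\Gamma)$: for $\varphi\in\mathrm{Aut}(\mathcal{E}_R)$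 write $\varphi(v_i)=\sum_{j=1}^n r_{ji}v_j$, $r=\det(r_{ij})\in R^\times$, and for $\sigma\in S_n$ put $e_\sigma^\varphi=\mathrm{sgn}(\sigma)\,r^{-1}r_{\sigma(1)1}\cdots r_{\sigma(n)n}$. When $\mathcal{E}^2=\mathcal{E}$, the $e_\sigma^\varphi$ are orthogonal idempotents of $R$ with sum $1$, and $e_\sigma^\varphi=0$ unless $\sigma\in\mathrm{Aut}(\Gamma)$. Then $\rho_R(\varphi)$ is the algebra homomorphism $\mathbb{F}^{\mathrm{Aut}(\Gamma)}\to R$, $\epsilon_\sigma\mapsto e_\sigma^\varphi$. In the claim, $\rho$ also denotes the map to $\mathsf{H}$ through which this $\rho$ factors. *)

(* Defs.v *)
From HB Require Import structures.
From mathcomp Require Import all_boot all_order all_fingroup all_algebra.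
From mathcomp Require Import boolp.
Set Implicit Arguments.
Unset Strict Implicit.
Unset Printing Implicit Defensive.
Import GRing.Theory.
Local Open Scope ring_scope.

(* MathComp's comAlgType excludes the zero algebra, so a unital commutative
   F-algebra is a commutative ring with a structure morphism from F. *)
Record algebra (F : fieldType) := Algebra {
  alg_sort :> comPzRingType;
  alg_str : {rmorphism F -> alg_sort}
}.

Record algHom (F : fieldType) (A B : algebra F) := AlgHom {
  algHom_fun :> {rmorphism A -> B};
  algHom_str : forall c, algHom_fun (alg_str A c) = alg_str B c
}.

Lemma rmorphism_ext (A B : pzRingType) (f g : {rmorphism A -> B}) :
  f =1 g -> f = g.
Proof.
case: f => [f [[[f0 fD]] [[f1 fM]]]]; case: g => [g [[[g0 gD]] [[g1 gM]]]] /=.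
move=> /funext efg; have {}efg : f = g := efg.
move: g0 gD g1 gM; rewrite -efg => g0 gD g1 gM.
by rewrite (Prop_irrelevance g0 f0) (Prop_irrelevance gD fD)
  (Prop_irrelevance g1 f1) (Prop_irrelevance gM fM).
Qed.

Lemma algHom_ext (F : fieldType) (A B : algebra F) (f g : algHom A B) :
  f =1 g -> f = g.
Proof.
case: f g => [f fs] [g gs] /= /rmorphism_ext efg.
by move: gs; rewrite -efg => gs; rewrite (Prop_irrelevance gs fs).
Qed.

HB.instance Definition _ (F : fieldType) (A B : algebra F) :=
  gen_eqMixin (algHom A B).
HB.instance Definition _ (F : fieldType) (A B : algebra F) :=
  gen_choiceMixin (algHom A B).

Definition algHom_id (F : fieldType) (A : algebra F) : algHom A A :=
  AlgHom (fun c => erefl : (idfun : {rmorphism A -> A}) _ = _).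

Lemma algHom_comp_str (F : fieldType) (A B C : algebra F)
  (g : algHom B C) (f : algHom A B) c :
  (g \o f : {rmorphism A -> C}) (alg_str A c) = alg_str C c.
Proof. by rewrite /= !algHom_str. Qed.

Definition algHom_comp (F : fieldType) (A B C : algebra F)
  (g : algHom B C) (f : algHom A B) : algHom A C :=
  AlgHom (algHom_comp_str g f).

Record groupFunctor (F : fieldType) := GroupFunctor {
  gobj :> algebra F -> groupType;
  gmap : forall A B : algebra F, algHom A B -> gobj A -> gobj B;
  gmapM : forall A B (h : algHom A B), {morph gmap h : x y / (x * y)%g};
  gmap_id : forall A (x : gobj A), gmap (algHom_id A) x = x;
  gmap_comp : forall A B C (g : algHom B C) (f : algHom A B) (x : gobj A),
    gmap (algHom_comp g f) x = gmap g (gmap f x)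
}.

Record groupHom (F : fieldType) (G H : groupFunctor F) := GroupHom {
  ghom :> forall A : algebra F, G A -> H A;
  ghomM : forall A, {morph @ghom A : x y / (x * y)%g};
  ghom_nat : forall A B (h : algHom A B) (x : G A),
    ghom (gmap h x) = gmap h (ghom x)
}.

Record representation (F : fieldType) (G : groupFunctor F) := Representation {
  rep_alg : algebra F;
  rep_iso : forall A : algebra F, algHom rep_alg A -> G A;
  rep_bij : forall A, bijective (@rep_iso A);
  rep_nat : forall A B (h : algHom A B) (f : algHom rep_alg A),
    rep_iso (algHom_comp h f) = gmap h (rep_iso f)
}.

Definition affine (F : fieldType) (G : groupFunctor F) : Prop :=
  inhabited (representation G).

(* The map of representing algebras that corresponds to f by Yoneda: the
   image under f of the universal point of G. *)
Definition is_comorphism (F : fieldType) (G H : groupFunctor F)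
    (f : groupHom G H) (rG : representation G) (rH : representation H)
    (h : algHom (rep_alg rH) (rep_alg rG)) : Prop :=
  rep_iso h = f (rep_alg rG) (rep_iso (algHom_id (rep_alg rG))).

(* Injectivity of the comorphism does not depend on the representations. *)
Definition quotient_map (F : fieldType) (G H : groupFunctor F)
    (f : groupHom G H) : Prop :=
  forall (rG : representation G) (rH : representation H) h,
    is_comorphism f (rG := rG) (rH := rH) h -> injective h.

Definition monomorphism (F : fieldType) (G H : groupFunctor F)
    (f : groupHom G H) : Prop :=
  forall A, injective (f A).

Definition short_exact (F : fieldType) (N G Q : groupFunctor F)
    (i : groupHom N G) (q : groupHom G Q) : Prop :=
  [/\ [/\ affine N, affine G & affine Q],
      monomorphism i,
      forall A (x : G A), q A x = 1%g <-> exists y : N A, i A y = x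
    & quotient_map q].

(* The inverse of a unit of a ring whose units need not be decidable. *)
Definition cinv (R : comPzRingType) (x : R) : R :=
  if pselect (exists y, x * y = 1) is left ex then projT1 (cid ex) else 0.

Lemma cinvP (R : comPzRingType) (x : R) :
  (exists y, x * y = 1) -> x * cinv x = 1.
Proof. by move=> ex; rewrite /cinv; case: pselect => // ex'; case: cid. Qed.

HB.instance Definition _ (T : finType) (R : comPzRingType) :=
  GRing.PzRing_hasCommutativeMul.Build {ffun T -> R} (@ffun_mulC T R).

Section FunAlgebra.
Context (F : fieldType) (T : finType).

Definition ffun_str (c : F) : {ffun T -> F} := [ffun=> c].

Fact ffun_str_zmod : zmod_morphism ffun_str.
Proof. by move=> a b; apply/ffunP=> t; rewrite !ffunE. Qed.
Fact ffun_str_monoid : GRing.monoid_morphism ffun_str.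
Proof. by split=> [|a b]; apply/ffunP=> t; rewrite !ffunE. Qed.
HB.instance Definition _ :=
  GRing.isZmodMorphism.Build F {ffun T -> F} ffun_str ffun_str_zmod.
HB.instance Definition _ :=
  GRing.isMonoidMorphism.Build F {ffun T -> F} ffun_str ffun_str_monoid.

Definition ffun_algebra : algebra F :=
  @Algebra F {ffun T -> F} (ffun_str : {rmorphism F -> {ffun T -> F}}).

Definition eps (t : T) : ffun_algebra := [ffun u => (u == t)%:R] : {ffun T -> F}.

End FunAlgebra.

Section PullBack.
Context (F : fieldType) (S T : finType) (k : S -> T).

Definition pull (f : ffun_algebra F T) : ffun_algebra F S :=
  [ffun s => (f : {ffun T -> F}) (k s)] : {ffun S -> F}.

Fact pull_zmod : zmod_morphism pull.
Proof. by move=> a b; apply/ffunP=> t; rewrite !ffunE. Qed.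
Fact pull_monoid : GRing.monoid_morphism pull.
Proof. by split=> [|a b]; apply/ffunP=> t; rewrite !ffunE. Qed.
HB.instance Definition _ := GRing.isZmodMorphism.Build _ _ pull pull_zmod.
HB.instance Definition _ := GRing.isMonoidMorphism.Build _ _ pull pull_monoid.

Fact pull_str c :
  (pull : {rmorphism _ -> _}) (alg_str (ffun_algebra F T) c)
  = alg_str (ffun_algebra F S) c.
Proof. by apply/ffunP=> t; rewrite !ffunE. Qed.

Definition pull_hom : algHom (ffun_algebra F T) (ffun_algebra F S) :=
  AlgHom pull_str.
End PullBack.

Section ConstantPoints.
Context (F : fieldType) (gT : finGroupType) (A : algebra F).

(* Hom(F^G, A), with the convolution product dual to G x G -> G. *)
Definition points : Type := algHom (ffun_algebra F gT) A.
HB.instance Definition _ := Choice.on points.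

Implicit Types (a b c : points) (f : {ffun gT -> F}) (g h k : gT).
Local Notation str := (alg_str A).

Lemma point_sum a f : a f = \sum_g str (f g) * a (eps F g).
Proof.
have {1}-> : f = \sum_g alg_str (ffun_algebra F gT) (f g) * eps F g.
  apply/ffunP=> g; rewrite sum_ffunE (bigD1 g) //= !ffunE eqxx mulr1.
  rewrite big1 ?addr0 // => h hg; rewrite !ffunE eq_sym (negPf hg) mulr0 //.
by rewrite rmorph_sum; apply: eq_bigr => g _ /=; rewrite rmorphM algHom_str.
Qed.

Lemma point_ext a b : (forall g, a (eps F g) = b (eps F g)) -> a = b.
Proof.
move=> ab; apply: algHom_ext => f; rewrite !point_sum.
by apply: eq_bigr => g _; rewrite ab.
Qed.

Lemma point_eps1 a : \sum_g a (eps F g) = 1.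
Proof.
rewrite -(rmorph1 a) [RHS]point_sum; apply: eq_bigr => g _.
by rewrite ffunE rmorph1 mul1r.
Qed.

Lemma point_epsM a g h : a (eps F g) * a (eps F h) = (g == h)%:R * a (eps F g).
Proof.
rewrite -rmorphM -(rmorph_nat a) -rmorphM; congr (a _); apply/ffunP=> k.
rewrite !ffunE; have -> : ((g == h)%:R : {ffun gT -> F}) k = (g == h)%:R.
  by case: (g == h); rewrite ffunE.
case: (eqVneq k g) => [->|_]; last by rewrite mul0r mulr0.
by rewrite mulrC.
Qed.

Definition cmul_fun a b (f : ffun_algebra F gT) : A :=
  \sum_g \sum_h str ((f : {ffun gT -> F}) (g * h)%g) * (a (eps F g) * b (eps F h)).

Fact cmul_zmod a b : zmod_morphism (cmul_fun a b).
Proof.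
move=> x y; rewrite /cmul_fun -sumrB; apply: eq_bigr => g _.
by rewrite -sumrB; apply: eq_bigr => h _; rewrite !ffunE rmorphB mulrBl.
Qed.
Fact cmul_monoid a b : GRing.monoid_morphism (cmul_fun a b).
Proof.
split=> [|x y].
  rewrite /cmul_fun -[RHS]mulr1 -{1}(point_eps1 a) -(point_eps1 b) mulr_suml.
  apply: eq_bigr => g _; rewrite mulr_sumr; apply: eq_bigr => h _.
  by rewrite ffunE rmorph1 mul1r.
rewrite /cmul_fun mulr_suml; apply: eq_bigr => g _.
rewrite mulr_suml; apply: eq_bigr => h _; rewrite mulr_sumr.
rewrite (bigD1 g) //= [X in _ + X]big1 ?addr0 => [|k kg]; last first.
  rewrite mulr_sumr big1 // => l _; rewrite mulrACA [X in _ * X]mulrACA.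
  by rewrite point_epsM eq_sym (negPf kg) !mul0r mulr0.
rewrite mulr_sumr (bigD1 h) //= [X in _ + X]big1 ?addr0 => [|l lh]; last first.
  rewrite mulrACA [X in _ * X]mulrACA.
  by rewrite [X in _ * (_ * X)]point_epsM eq_sym (negPf lh) !mul0r !mulr0.
rewrite mulrACA [X in _ = _ * X]mulrACA !point_epsM !eqxx !mul1r.
by rewrite !ffunE rmorphM.
Qed.
HB.instance Definition _ a b :=
  GRing.isZmodMorphism.Build _ _ (cmul_fun a b) (cmul_zmod a b).
HB.instance Definition _ a b :=
  GRing.isMonoidMorphism.Build _ _ (cmul_fun a b) (cmul_monoid a b).

Fact cmul_str a b (c : F) :
  (cmul_fun a b : {rmorphism _ -> _}) (alg_str (ffun_algebra F gT) c)
  = alg_str A c.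
Proof.
rewrite -[RHS]mulr1 -(rmorph1 (cmul_fun a b)) /= /cmul_fun mulr_sumr.
apply: eq_bigr => g _; rewrite mulr_sumr; apply: eq_bigr => h _.
by rewrite !ffunE rmorph1 mul1r.
Qed.
Definition cmul a b : points := AlgHom (cmul_str a b).

Lemma cmulE a b f :
  cmul a b f = \sum_g \sum_h str (f (g * h)%g) * (a (eps F g) * b (eps F h)).
Proof. by []. Qed.

Definition cone_fun (f : ffun_algebra F gT) : A :=
  str ((f : {ffun gT -> F}) 1%g).
Fact cone_zmod : zmod_morphism cone_fun.
Proof. by move=> x y; rewrite /cone_fun !ffunE rmorphB. Qed.
Fact cone_monoid : GRing.monoid_morphism cone_fun.
Proof. by split=> [|x y]; rewrite /cone_fun !ffunE ?rmorph1 ?rmorphM. Qed.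
HB.instance Definition _ :=
  GRing.isZmodMorphism.Build _ _ cone_fun cone_zmod.
HB.instance Definition _ :=
  GRing.isMonoidMorphism.Build _ _ cone_fun cone_monoid.
Fact cone_str (c : F) :
  (cone_fun : {rmorphism _ -> _}) (alg_str (ffun_algebra F gT) c)
  = alg_str A c.
Proof. by rewrite /= /cone_fun !ffunE. Qed.
Definition cone : points := AlgHom cone_str.

Definition cinvp a : points := algHom_comp a (pull_hom F (@invg gT)).

Lemma cinvp_eps a g : cinvp a (eps F g) = a (eps F g^-1%g).
Proof.
rewrite /cinvp /=; congr (a _); apply/ffunP=> h; rewrite !ffunE.
by rewrite (canF_eq (@invgK gT)).
Qed.

Lemma cone_eps g : cone (eps F g) = (g == 1%g)%:R.
Proof. by rewrite /= /cone_fun ffunE rmorph_nat eq_sym. Qed.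

Lemma cmul_sum a b (u : gT -> A) :
  \sum_k u k * cmul a b (eps F k)
  = \sum_g \sum_h u (g * h)%g * (a (eps F g) * b (eps F h)).
Proof.
under eq_bigr do rewrite cmulE mulr_sumr.
rewrite exchange_big; apply: eq_bigr => g _ /=.
under eq_bigr do rewrite mulr_sumr.
rewrite exchange_big; apply: eq_bigr => h _ /=.
rewrite (bigD1 (g * h)%g) //= ffunE eqxx rmorph1 mul1r big1 ?addr0 // => k kn.
by rewrite ffunE eq_sym (negPf kn) rmorph0 mul0r mulr0.
Qed.

Fact cmulA : associative cmul.
Proof.
move=> a b c; apply: algHom_ext => f; rewrite !cmulE.
transitivity (\sum_g \sum_h \sum_k str (f (g * h * k)%g) *
    (a (eps F g) * b (eps F h) * c (eps F k))).
  apply: eq_bigr => g _.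
  transitivity (\sum_h str (f (g * h)%g) * a (eps F g) * cmul b c (eps F h)).
    by apply: eq_bigr => h _; rewrite mulrA.
  rewrite (cmul_sum b c (fun x => str (f (g * x)%g) * a (eps F g))).
  by apply: eq_bigr => h _; apply: eq_bigr => k _; rewrite mulgA !mulrA.
rewrite [RHS]exchange_big /=.
transitivity (\sum_k \sum_g \sum_h str (f (g * h * k)%g) * c (eps F k)
    * (a (eps F g) * b (eps F h))); last first.
  apply: eq_bigr => k _.
  rewrite -(cmul_sum a b (fun x => str (f (x * k)%g) * c (eps F k))).
  by apply: eq_bigr => g _; rewrite -!mulrA; congr (_ * _); rewrite mulrC.
rewrite [RHS]exchange_big; apply: eq_bigr => g _ /=.
rewrite [RHS]exchange_big; apply: eq_bigr => h _; apply: eq_bigr => k _ /=.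
by rewrite -!mulrA; congr (_ * _); rewrite mulrA [RHS]mulrC.
Qed.

Fact cmul1p : left_id cone cmul.
Proof.
move=> a; apply: algHom_ext => f; rewrite cmulE (bigD1 1%g) //=.
rewrite [X in _ + X]big1 ?addr0 => [|g gn]; last first.
  by rewrite big1 // => h _; rewrite -/cone (cone_eps g) (negPf gn) mul0r mulr0.
rewrite [RHS]point_sum; apply: eq_bigr => h _.
by rewrite (cone_eps 1%g) eqxx mul1r mul1g.
Qed.

Fact cmulp1 : right_id cone cmul.
Proof.
move=> a; apply: algHom_ext => f; rewrite cmulE [RHS]point_sum.
apply: eq_bigr => g _; rewrite (bigD1 1%g) //= [X in _ + X]big1 ?addr0.
  by rewrite (cone_eps 1%g) eqxx mulr1 mulg1.
by move=> h hn; rewrite (cone_eps h) (negPf hn) !mulr0.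
Qed.

Fact cmulVp : left_inverse cone cinvp cmul.
Proof.
move=> a; apply: algHom_ext => f; rewrite cmulE.
transitivity (\sum_g str (f 1%g) * a (eps F g)); last first.
  by rewrite -mulr_sumr point_eps1 mulr1.
rewrite (reindex_inj invg_inj); apply: eq_bigr => g _.
rewrite (eq_bigr (fun h => str (f (g^-1 * h)%g) * ((g == h)%:R * a (eps F g)))).
  rewrite (bigD1 g) //= [X in _ + X]big1 ?addr0 => [|h hn].
    by rewrite mulVg eqxx mul1r.
  by rewrite eq_sym (negPf hn) mul0r mulr0.
by move=> h _; rewrite (cinvp_eps a) invgK point_epsM.
Qed.

Fact cmulpV : right_inverse cone cinvp cmul.
Proof.
move=> a; apply: algHom_ext => f; rewrite cmulE.
transitivity (\sum_g str (f 1%g) * a (eps F g)); last first.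
  by rewrite -mulr_sumr point_eps1 mulr1.
apply: eq_bigr => g _; rewrite (reindex_inj invg_inj).
rewrite (eq_bigr (fun h => str (f (g * h^-1)%g) * ((g == h)%:R * a (eps F g)))).
  rewrite (bigD1 g) //= [X in _ + X]big1 ?addr0 => [|h hn].
    by rewrite mulgV eqxx mul1r.
  by rewrite eq_sym (negPf hn) mul0r mulr0.
by move=> h _; rewrite (cinvp_eps a) invgK point_epsM.
Qed.

HB.instance Definition _ :=
  isGroup.Build points cmulA cmul1p cmulp1 cmulVp cmulpV.

End ConstantPoints.

Section ConstantScheme.
Context (F : fieldType) (gT : finGroupType).

Definition const_map (A B : algebra F) (h : algHom A B) (a : points gT A) :
  points gT B := algHom_comp h a.

Fact const_mapM A B (h : algHom A B) :
  {morph const_map h : x y / (x * y)%g}.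
Proof.
move=> a b; apply: algHom_ext => f.
rewrite /= [LHS]rmorph_sum; apply: eq_bigr => g _ /=.
rewrite rmorph_sum; apply: eq_bigr => k _ /=.
by rewrite !rmorphM algHom_str.
Qed.
Fact const_map_id A (x : points gT A) : const_map (algHom_id A) x = x.
Proof. exact: algHom_ext. Qed.
Fact const_map_comp A B C (g : algHom B C) (f : algHom A B) (x : points gT A) :
  const_map (algHom_comp g f) x = const_map g (const_map f x).
Proof. exact: algHom_ext. Qed.

Definition const_scheme : groupFunctor F :=
  @GroupFunctor F (fun A => points gT A) const_map
    const_mapM const_map_id const_map_comp.
End ConstantScheme.

(* Restriction of functions F^G -> F^H, for H \subset G; composing with it
   embeds the constant scheme of H into that of G. *)
Definition restr (F : fieldType) (gT : finGroupType) (H G : {group gT}) :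
    algHom (ffun_algebra F (subg_of G)) (ffun_algebra F (subg_of H)) :=
  pull_hom F (fun h : subg_of H => subg G (sgval h)).

Section Graph.
Context (V : finType) (e : rel V).

Definition graph_aut_set : {set {perm V}} :=
  [set s : {perm V} | [forall v, forall w, e v w ==> e (s v) (s w)]].

Fact graph_aut_group_set : group_set graph_aut_set.
Proof.
apply/group_setP; split=> [|s t].
  by rewrite inE; apply/'forall_forallP => v w; rewrite !perm1; apply/implyP.
rewrite !inE => /'forall_forallP Hs /'forall_forallP Ht.
apply/'forall_forallP => v w; apply/implyP => /(implyP (Hs v w)).
by rewrite !permM => /(implyP (Ht _ _)).
Qed.
Canonical graph_aut : {group {perm V}} := Group graph_aut_group_set.

Context (F : fieldType).

Record diag (A : algebra F) := DiagPoint {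
  diag_fun :> {ffun V -> A};
  diag_unit : forall v, exists y, diag_fun v * y = 1;
  diag_edge : forall v w, e v w -> diag_fun w = diag_fun v ^+ 2
}.
HB.instance Definition _ A := gen_eqMixin (diag A).
HB.instance Definition _ A := gen_choiceMixin (diag A).

Lemma diag_ext A (x y : diag A) : (forall v, x v = y v) -> x = y.
Proof.
case: x y => [x xu xe] [y yu ye] /= /ffunP exy.
move: yu ye; rewrite -exy => yu ye.
by rewrite (Prop_irrelevance yu xu) (Prop_irrelevance ye xe).
Qed.

Section Ops.
Context (A : algebra F).
Implicit Types x y z : diag A.

Definition diag_one_fun : {ffun V -> A} := [ffun=> 1].
Fact diag_one_unit v : exists a : A, diag_one_fun v * a = 1.
Proof. by exists 1; rewrite ffunE mulr1. Qed.
Fact diag_one_edge v w : e v w -> diag_one_fun w = diag_one_fun v ^+ 2.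
Proof. by rewrite !ffunE expr1n. Qed.
Definition diag_one := DiagPoint diag_one_unit diag_one_edge.

Definition diag_mul_fun x y : {ffun V -> A} := [ffun v => x v * y v].
Fact diag_mul_unit x y v : exists a : A, diag_mul_fun x y v * a = 1.
Proof.
have [[a xa] [b yb]] := (diag_unit x v, diag_unit y v).
by exists (a * b); rewrite ffunE mulrACA xa yb mulr1.
Qed.
Fact diag_mul_edge x y v w : e v w -> diag_mul_fun x y w = diag_mul_fun x y v ^+ 2.
Proof. by move=> vw; rewrite !ffunE (diag_edge x vw) (diag_edge y vw) exprMn. Qed.
Definition diag_mul x y := DiagPoint (diag_mul_unit x y) (@diag_mul_edge x y).

Definition diag_inv_fun x : {ffun V -> A} := [ffun v => cinv (x v)].
Fact diag_inv_unit x v : exists a : A, diag_inv_fun x v * a = 1.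
Proof. by exists (x v); rewrite ffunE mulrC cinvP //; apply: diag_unit. Qed.
Fact diag_inv_edge x v w : e v w -> diag_inv_fun x w = diag_inv_fun x v ^+ 2.
Proof.
move=> vw; rewrite !ffunE -[RHS]mulr1 -(cinvP (diag_unit x w)) mulrA.
rewrite [X in _ = _ * X * _](diag_edge x vw) -exprMn [_ * x v]mulrC.
by rewrite cinvP ?expr1n ?mul1r //; apply: diag_unit.
Qed.
Definition diag_inv x := DiagPoint (diag_inv_unit x) (@diag_inv_edge x).

Fact diag_mulA : associative diag_mul.
Proof. by move=> x y z; apply: diag_ext => v; rewrite !ffunE mulrA. Qed.
Fact diag_mulC : commutative diag_mul.
Proof. by move=> x y; apply: diag_ext => v; rewrite !ffunE mulrC. Qed.
Fact diag_mul1 : left_id diag_one diag_mul.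
Proof. by move=> x; apply: diag_ext => v; rewrite !ffunE mul1r. Qed.
Fact diag_mul1r : right_id diag_one diag_mul.
Proof. by move=> x; rewrite diag_mulC diag_mul1. Qed.
Fact diag_mulrV : right_inverse diag_one diag_inv diag_mul.
Proof.
by move=> x; apply: diag_ext => v; rewrite !ffunE cinvP //; apply: diag_unit.
Qed.
Fact diag_mulVr : left_inverse diag_one diag_inv diag_mul.
Proof. by move=> x; rewrite diag_mulC diag_mulrV. Qed.
HB.instance Definition _ := isGroup.Build (diag A)
  diag_mulA diag_mul1 diag_mul1r diag_mulVr diag_mulrV.
End Ops.

Section Map.
Context (A B : algebra F) (h : algHom A B).
Definition diag_map_fun (x : diag A) : {ffun V -> B} := [ffun v => h (x v)].
Fact diag_map_unit x v : exists z, diag_map_fun x v * z = 1.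
Proof.
by have [a xa] := diag_unit x v; exists (h a); rewrite ffunE -rmorphM xa rmorph1.
Qed.
Fact diag_map_edge x v w : e v w -> diag_map_fun x w = diag_map_fun x v ^+ 2.
Proof. by move=> vw; rewrite !ffunE (diag_edge x vw) rmorphXn. Qed.
Definition diag_map x := DiagPoint (diag_map_unit x) (@diag_map_edge x).
Fact diag_mapM : {morph diag_map : x y / (x * y)%g}.
Proof. by move=> x y; apply: diag_ext => v; rewrite !ffunE rmorphM. Qed.
End Map.

Fact diag_map_id A (x : diag A) : diag_map (algHom_id A) x = x.
Proof. by apply: diag_ext => v; rewrite ffunE. Qed.
Fact diag_map_comp A B C (g : algHom B C) (f : algHom A B) (x : diag A) :
  diag_map (algHom_comp g f) x = diag_map g (diag_map f x).
Proof. by apply: diag_ext => v; rewrite !ffunE. Qed.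

Definition DiagScheme : groupFunctor F :=
  @GroupFunctor F (fun A => diag A) diag_map diag_mapM diag_map_id diag_map_comp.
End Graph.

Section AlgebraAut.
Context (F : fieldType) (E : vectType F) (mul : {bilinear E -> E -> E}).
Context (n : nat) (B : n.-tuple E).

(* E^2 = E, where E^2 is the span of all products. *)
Definition perfect : Prop :=
  forall x : E, exists s : seq (F * (E * E)),
    x = \sum_(t <- s) t.1 *: mul t.2.1 t.2.2.

Definition natural_basis : Prop :=
  basis_of fullv B /\
  (forall i j : 'I_n, i != j -> mul (tnth B i) (tnth B j) = 0).

Definition struct_mx : 'M[F]_n :=
  \matrix_(i, j) coord B j (mul (tnth B i) (tnth B i)).

(* The vertex v_i is represented by its index i. *)
Definition evol_graph : rel 'I_n := fun i j => struct_mx i j != 0.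

(* For a basis B, the algebra E (x) A is free over A on the v_i (x) 1; it is
   represented by coordinates in that basis. *)
Definition ext_mul (A : algebra F) (x y : 'rV[A]_n) : 'rV[A]_n :=
  \row_k \sum_i \sum_j
    x 0 i * y 0 j * alg_str A (coord B k (mul (tnth B i) (tnth B j))).

Definition ext_vec (A : algebra F) (x : E) : 'rV[A]_n :=
  \row_k alg_str A (coord B k x).

Record ext_aut (A : algebra F) := ExtAut {
  ext_aut_fun :> {linear 'rV[A]_n -> 'rV[A]_n};
  ext_aut_bij : bijective ext_aut_fun;
  ext_autM : {morph ext_aut_fun : x y / ext_mul x y}
}.
HB.instance Definition _ A := gen_eqMixin (ext_aut A).
HB.instance Definition _ A := gen_choiceMixin (ext_aut A).

Lemma linear_ext (R : pzRingType) (U V : lmodType R) (f g : {linear U -> V}) :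
  f =1 g -> f = g.
Proof.
case: f => [f [[[f0 fD]] [fZ]]]; case: g => [g [[[g0 gD]] [gZ]]] /=.
move=> /funext efg; have {}efg : f = g := efg.
move: g0 gD gZ; rewrite -efg => g0 gD gZ.
by rewrite (Prop_irrelevance g0 f0) (Prop_irrelevance gD fD)
  (Prop_irrelevance gZ fZ).
Qed.

Lemma ext_aut_ext A (f g : ext_aut A) : f =1 g -> f = g.
Proof.
case: f g => [f fb fM] [g gb gM] /= /linear_ext efg.
move: gb gM; rewrite -efg => gb gM.
by rewrite (Prop_irrelevance gb fb) (Prop_irrelevance gM fM).
Qed.

Section Ops.
Context (A : algebra F).
Implicit Types f g : ext_aut A.
Local Notation M := 'rV[A]_n.

Fact aut_oneM : {morph (idfun : {linear M -> M}) : x y / ext_mul x y}.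
Proof. by []. Qed.
Definition aut_one : ext_aut A :=
  @ExtAut A (idfun : {linear M -> M}) (inv_bij (fun=> erefl)) aut_oneM.

(* Composition in diagrammatic order, as for MathComp's permutations. *)
Fact aut_mul_bij f g : bijective (g \o f : {linear M -> M}).
Proof. exact: bij_comp (ext_aut_bij g) (ext_aut_bij f). Qed.
Fact aut_mulM f g : {morph (g \o f : {linear M -> M}) : x y / ext_mul x y}.
Proof. by move=> x y; rewrite /= !ext_autM. Qed.
Definition aut_mul f g : ext_aut A := ExtAut (aut_mul_bij f g) (aut_mulM f g).

Fact aut_inv_ex f : exists g : M -> M, cancel f g /\ cancel g f.
Proof. by have [g fK gK] := ext_aut_bij f; exists g. Qed.
Definition aut_inv_fun f : M -> M := projT1 (cid (aut_inv_ex f)).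
Fact aut_invK f : cancel f (aut_inv_fun f).
Proof. by rewrite /aut_inv_fun; case: cid => ? []. Qed.
Fact aut_invKV f : cancel (aut_inv_fun f) f.
Proof. by rewrite /aut_inv_fun; case: cid => ? []. Qed.
Fact aut_inv_linear f : linear (aut_inv_fun f).
Proof.
by move=> a u v; apply: (can_inj (aut_invK f)); rewrite linearP !aut_invKV.
Qed.
HB.instance Definition _ f :=
  GRing.isLinear.Build A M M *:%R (aut_inv_fun f) (aut_inv_linear f).
Fact aut_inv_bij f : bijective (aut_inv_fun f).
Proof. by exists f; [apply: aut_invKV | apply: aut_invK]. Qed.
Fact aut_invM f : {morph aut_inv_fun f : x y / ext_mul x y}.
Proof.
by move=> x y; apply: (can_inj (aut_invK f)); rewrite ext_autM !aut_invKV.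
Qed.
Definition aut_inv f : ext_aut A := ExtAut (aut_inv_bij f) (@aut_invM f).

Fact aut_mulA : associative aut_mul.
Proof. by move=> f g h; apply: ext_aut_ext. Qed.
Fact aut_mul1 : left_id aut_one aut_mul.
Proof. by move=> f; apply: ext_aut_ext. Qed.
Fact aut_mul1r : right_id aut_one aut_mul.
Proof. by move=> f; apply: ext_aut_ext. Qed.
Fact aut_mulV : left_inverse aut_one aut_inv aut_mul.
Proof. by move=> f; apply: ext_aut_ext => x; apply: aut_invKV. Qed.
Fact aut_mulrV : right_inverse aut_one aut_inv aut_mul.
Proof. by move=> f; apply: ext_aut_ext => x; apply: aut_invK. Qed.
HB.instance Definition _ := isGroup.Build (ext_aut A)
  aut_mulA aut_mul1 aut_mul1r aut_mulV aut_mulrV.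
End Ops.

Lemma ext_mul_suml (A : algebra F) (I : Type) (r : seq I) (u : I -> 'rV[A]_n)
    (y : 'rV[A]_n) :
  ext_mul (\sum_(i <- r) u i) y = \sum_(i <- r) ext_mul (u i) y.
Proof.
apply/rowP => k; rewrite summxE !mxE.
rewrite [RHS](eq_bigr (fun t => \sum_i \sum_j u t 0 i * y 0 j *
  alg_str A (coord B k (mul (tnth B i) (tnth B j))))); last first.
  by move=> t _; rewrite mxE.
rewrite [RHS]exchange_big; apply: eq_bigr => i _ /=.
rewrite [RHS]exchange_big; apply: eq_bigr => j _ /=.
by rewrite summxE !mulr_suml.
Qed.

Lemma ext_mul_sumr (A : algebra F) (I : Type) (r : seq I) (u : I -> 'rV[A]_n)
    (x : 'rV[A]_n) :
  ext_mul x (\sum_(i <- r) u i) = \sum_(i <- r) ext_mul x (u i).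
Proof.
apply/rowP => k; rewrite summxE !mxE.
rewrite [RHS](eq_bigr (fun t => \sum_i \sum_j x 0 i * u t 0 j *
  alg_str A (coord B k (mul (tnth B i) (tnth B j))))); last first.
  by move=> t _; rewrite mxE.
rewrite [RHS]exchange_big; apply: eq_bigr => i _ /=.
rewrite [RHS]exchange_big; apply: eq_bigr => j _ /=.
by rewrite summxE mulr_sumr !mulr_suml.
Qed.

Lemma ext_mulZl (A : algebra F) (a : A) (x y : 'rV[A]_n) : ext_mul (a *: x) y = a *: ext_mul x y.
Proof.
apply/rowP => k; rewrite !mxE mulr_sumr; apply: eq_bigr => i _.
by rewrite mulr_sumr; apply: eq_bigr => j _; rewrite mxE !mulrA.
Qed.

Lemma ext_mulZr (A : algebra F) (a : A) (x y : 'rV[A]_n) : ext_mul x (a *: y) = a *: ext_mul x y.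
Proof.
apply/rowP => k; rewrite !mxE mulr_sumr; apply: eq_bigr => i _.
rewrite mulr_sumr; apply: eq_bigr => j _.
by rewrite mxE -!mulrA mulrCA.
Qed.

Lemma ext_mul_map (A C : algebra F) (h : algHom A C) (x y : 'rV[A]_n) :
  map_mx h (ext_mul x y) = ext_mul (map_mx h x) (map_mx h y).
Proof.
apply/rowP => k; rewrite !mxE rmorph_sum; apply: eq_bigr => i _ /=.
rewrite rmorph_sum; apply: eq_bigr => j _ /=.
by rewrite !mxE !rmorphM algHom_str.
Qed.

(* ext_vec is x |-> x (x) 1; it sends v_i to 'e_i and is multiplicative. *)
Lemma ext_vec_basis (A : algebra F) i : basis_of fullv B ->
  ext_vec A (tnth B i) = delta_mx 0 i.
Proof.
move=> /andP[_ fB]; apply/rowP => k.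
by rewrite !mxE (tnth_nth 0) coord_free //= rmorph_nat eq_sym.
Qed.

Lemma ext_vecM A (x y : E) : basis_of fullv B ->
  ext_vec A (mul x y) = ext_mul (ext_vec A x) (ext_vec A y).
Proof.
move=> /andP[/eqP sB _].
have dec z : z = \sum_i coord B i z *: tnth B i.
  rewrite {1}(@coord_span _ _ _ B z) ?sB ?memvf //.
  by apply: eq_bigr => i _; rewrite (tnth_nth 0).
apply/rowP => k; rewrite !mxE {1}(dec x) {1}(dec y).
rewrite linear_sumlz raddf_sum rmorph_sum; apply: eq_bigr => i _ /=.
rewrite linear_sumr raddf_sum rmorph_sum; apply: eq_bigr => j _ /=.
by rewrite linearZl_LR linearZr_LR !linearZ /= !rmorphM !mxE mulrA.
Qed.

Section Map.
Context (A C : algebra F) (h : algHom A C).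
Local Notation M := 'rV[C]_n.

(* The C-linear extension of f : matrices are acted on by h entrywise. *)
Definition aut_map_fun (f : ext_aut A) (x : M) : M :=
  x *m map_mx h (lin1_mx f).

Fact aut_map_linear f : linear (aut_map_fun f).
Proof. by move=> a u v; rewrite /aut_map_fun mulmxDl scalemxAl. Qed.
HB.instance Definition _ f :=
  GRing.isLinear.Build C M M *:%R (aut_map_fun f) (aut_map_linear f).

Lemma aut_mapE f (x : 'rV[A]_n) : aut_map_fun f (map_mx h x) = map_mx h (f x).
Proof. by rewrite /aut_map_fun -map_mxM mul_rV_lin1. Qed.

Lemma linear_eq_delta (R : pzRingType) m (u v : {linear 'rV[R]_m -> 'rV[R]_n}) :
  (forall i, u (delta_mx 0 i) = v (delta_mx 0 i)) -> u =1 v.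
Proof.
move=> uv x; rewrite (row_sum_delta x) !linear_sum.
by apply: eq_bigr => i _; rewrite !linearZ /= uv.
Qed.

Fact aut_map_can (f g : ext_aut A) :
  cancel f g -> cancel (aut_map_fun f) (aut_map_fun g).
Proof.
move=> fK x; rewrite /aut_map_fun -mulmxA -map_mxM.
suff -> : lin1_mx f *m lin1_mx g = 1%:M by rewrite map_mx1 mulmx1.
apply/row_matrixP => i.
by rewrite row_mul rowE !mul_rV_lin1 fK row1.
Qed.
Fact aut_map_bij f : bijective (aut_map_fun f).
Proof.
exists (aut_map_fun (aut_inv f)); apply: aut_map_can.
  exact: aut_invK.
exact: aut_invKV.
Qed.
Fact aut_mapM f : {morph aut_map_fun f : x y / ext_mul x y}.
Proof.
move=> x y; rewrite {1}(row_sum_delta x) {1}(row_sum_delta y).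
rewrite [in RHS](row_sum_delta x) [in RHS](row_sum_delta y).
rewrite !linear_sum !ext_mul_suml linear_sum; apply: eq_bigr => i _.
rewrite !ext_mul_sumr linear_sum; apply: eq_bigr => j _.
rewrite !linearZ /= !ext_mulZl !ext_mulZr !linearZ /=.
rewrite -(map_delta_mx h _ i) -(map_delta_mx h _ j) -ext_mul_map !aut_mapE.
by rewrite ext_autM ext_mul_map !scalerA mulrC.
Qed.
Definition aut_map f : ext_aut C := ExtAut (aut_map_bij f) (@aut_mapM f).

Fact aut_map_morph : {morph aut_map : f g / (f * g)%g}.
Proof.
move=> f g; apply: ext_aut_ext; apply: linear_eq_delta => i.
by rewrite /= -(map_delta_mx h) !aut_mapE.
Qed.
End Map.

Fact aut_map_id A (f : ext_aut A) : aut_map (algHom_id A) f = f.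
Proof.
apply: ext_aut_ext => x.
by rewrite /= /aut_map_fun map_mx_id ?mul_rV_lin1.
Qed.
Fact aut_map_comp A C D (g : algHom C D) (k : algHom A C) (f : ext_aut A) :
  aut_map (algHom_comp g k) f = aut_map g (aut_map k f).
Proof.
apply: ext_aut_ext; apply: linear_eq_delta => i /=.
rewrite -(map_delta_mx (algHom_comp g k)) aut_mapE.
rewrite [in RHS]map_mx_comp aut_mapE /= aut_mapE.
by apply/rowP => j; rewrite !mxE.
Qed.

Definition AutScheme : groupFunctor F :=
  @GroupFunctor F (fun A => ext_aut A) aut_map aut_map_morph
    aut_map_id aut_map_comp.

(* The matrix (r_ji) with f (v_i) = \sum_j r_ji v_j. *)
Definition aut_mx A (f : ext_aut A) : 'M[A]_n :=
  \matrix_(j, i) f (delta_mx 0 i) 0 j.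

Definition e_coef A (f : ext_aut A) (s : 'S_n) : A :=
  (-1) ^+ s * cinv (\det (aut_mx f)) * \prod_i aut_mx f (s i) i.

Section Iota.
Context (natB : natural_basis) (A : algebra F).
Local Notation M := 'rV[A]_n.

Definition iota_fun (p : diag evol_graph A) (x : M) : M :=
  \row_i (p i * x 0 i).
Fact iota_linear p : linear (iota_fun p).
Proof. by move=> a u v; apply/rowP=> i; rewrite !mxE mulrDr mulrCA. Qed.
HB.instance Definition _ p :=
  GRing.isLinear.Build A M M *:%R (iota_fun p) (iota_linear p).
Fact iota_bij p : bijective (iota_fun p).
Proof.
exists (iota_fun (diag_inv p)) => x; apply/rowP => i; rewrite !mxE ffunE mulrA.
  by rewrite [_ * p i]mulrC cinvP ?mul1r //; apply: diag_unit.
by rewrite cinvP ?mul1r //; apply: diag_unit.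
Qed.
Fact iota_autM p : {morph iota_fun p : x y / ext_mul x y}.
Proof.
move=> x y; apply/rowP => k; rewrite !mxE mulr_sumr; apply: eq_bigr => i _.
rewrite mulr_sumr; apply: eq_bigr => j _; rewrite !mxE.
have [<-|ij] := eqVneq i j; last first.
  by rewrite natB.2 // linear0 rmorph0 !mulr0.
have [->|ck] := eqVneq (coord B k (mul (tnth B i) (tnth B i))) 0.
  by rewrite rmorph0 !mulr0.
have /(diag_edge p) -> : evol_graph i k by rewrite /evol_graph mxE.
by rewrite expr2 mulrA; congr (_ * _); rewrite mulrACA.
Qed.
Definition iota_aut p : ext_aut A := ExtAut (iota_bij p) (@iota_autM p).
Fact iotaM : {morph iota_aut : p q / (p * q)%g}.
Proof.
move=> p q; apply: ext_aut_ext => x; apply/rowP => i.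
by rewrite /= !mxE ffunE mulrA [q i * _]mulrC.
Qed.
End Iota.

Fact iota_nat natB A C (h : algHom A C) (p : diag evol_graph A) :
  iota_aut natB (diag_map h p) = aut_map h (iota_aut natB p).
Proof.
apply: ext_aut_ext; apply: linear_eq_delta => i.
rewrite /= -(map_delta_mx h) aut_mapE; apply/rowP => j.
by rewrite !mxE ffunE rmorphM.
Qed.

Definition iota_hom (natB : natural_basis) :
    groupHom (DiagScheme evol_graph F) AutScheme :=
  @GroupHom F (DiagScheme evol_graph F) AutScheme
    (iota_aut natB) (iotaM natB) (@iota_nat natB).
End AlgebraAut.

(* Main.v *)
(** The idempotents [e_s] of an automorphism are orthogonal with sum 1, so they
define a point of the constant scheme of any group containing all [s] with
[e_s <> 0] for some automorphism over some algebra. Such [s] must form a group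
[H] for the sequence to be exact on the right, and this is the only hard point:
it asks that nonvanishing be stable under tensor products. We avoid these as
follows. On the part where [e_s] is 1 an automorphism is monomial,
[v_i |-> x_i v_(s i)], with units [x_i] satisfying the binomial equations
[alpha_(s i)(s j) x_i^2 = alpha_ij x_j]. Recording which monomials in the
[x_i] are multiples of [e_s] by scalars gives an [F]-valued function [f] on
monomials with [f 0 = 1], invariant under the binomial equations. Conversely
such an [f] is a nonzero vector of a module over the universal algebra of the
binomial equations, which is therefore nonzero and carries an automorphism with
[e_s = 1]. Invariant functions for [s] and [t] multiply to one for [s * t]. *)

Require Import Defs.
From HB Require Import structures.
From mathcomp Require Import all_boot all_order all_fingroup all_algebra.
From mathcomp Require Import boolp.
Set Implicit Arguments.
Unset Strict Implicit.
Unset Printing Implicit Defensive.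
Import GRing.Theory.
Local Open Scope ring_scope.

(** * Algebras given by generators and relations *)

(** Polynomials over F before any identification, so that an algebra given by generators and
    relations is a single quotient by a congruence. Opposites are products with [Const (-1)]. *)
Inductive term (F : fieldType) (T : Type) : Type :=
| Var of T
| Const of F
| Add of term F T & term F T
| Mul of term F T & term F T.
Arguments Var {F T}.
Arguments Const {F T}.

HB.instance Definition _ (F : fieldType) (T : Type) := gen_eqMixin (term F T).
HB.instance Definition _ (F : fieldType) (T : Type) :=
  gen_choiceMixin (term F T).

Section Presentation.
Context (F : fieldType) (T : Type) (rel : term F T -> term F T -> Prop).
Implicit Types s t u : term F T.

(** The least congruence that contains [rel] and the axioms of commutative F-algebras. The quotient
    is the polynomial ring F[T] modulo the ideal generated by the differences t - u with
    [rel t u]. *)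
Inductive cong : term F T -> term F T -> Prop :=
| cong_rel t u : rel t u -> cong t u
| cong_refl t : cong t t
| cong_sym t u : cong t u -> cong u t
| cong_trans t u s : cong t u -> cong u s -> cong t s
| cong_add t t' u u' : cong t t' -> cong u u' -> cong (Add t u) (Add t' u')
| cong_mul t t' u u' : cong t t' -> cong u u' -> cong (Mul t u) (Mul t' u')
| cong_addA t u s : cong (Add t (Add u s)) (Add (Add t u) s)
| cong_addC t u : cong (Add t u) (Add u t)
| cong_add0 t : cong (Add (Const 0) t) t
| cong_addN t : cong (Add (Mul (Const (-1)) t) t) (Const 0)
| cong_mulA t u s : cong (Mul t (Mul u s)) (Mul (Mul t u) s)
| cong_mulC t u : cong (Mul t u) (Mul u t)
| cong_mul1 t : cong (Mul (Const 1) t) t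
| cong_mulDl t u s : cong (Mul (Add t u) s) (Add (Mul t s) (Mul u s))
| cong_constD a b : cong (Const (a + b)) (Add (Const a) (Const b))
| cong_constM a b : cong (Const (a * b)) (Mul (Const a) (Const b)).

Definition congb t u : bool := `[< cong t u >].
Fact congb_refl : reflexive congb.
Proof. by move=> t; apply/asboolP; apply: cong_refl. Qed.
Fact congb_sym : symmetric congb.
Proof. by move=> t u; apply/asbool_equiv_eq; split; apply: cong_sym. Qed.
Fact congb_trans : transitive congb.
Proof.
by move=> u t s /asboolP tu /asboolP us; apply/asboolP; apply: cong_trans us.
Qed.
Canonical cong_equiv := EquivRel congb congb_refl congb_sym congb_trans.

Definition pres : Type := {eq_quot cong_equiv}%qT.
HB.instance Definition _ := Choice.on pres.

Definition cls (t : term F T) : pres := (\pi_({eq_quot cong_equiv}) t)%qT.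
Definition rep (x : pres) : term F T := generic_quotient.repr (x : {eq_quot cong_equiv}%qT).

Lemma clsP t u : cls t = cls u <-> cong t u.
Proof.
by split=> [/eqmodP /asboolP | tu]; last by apply/eqmodP/asboolP.
Qed.
Lemma repK x : cls (rep x) = x.
Proof. exact: reprK. Qed.
Lemma clsK t : cong (rep (cls t)) t.
Proof. by apply/clsP; rewrite repK. Qed.

Definition pres_add x y := cls (Add (rep x) (rep y)).
Definition pres_mul x y := cls (Mul (rep x) (rep y)).
Definition pres_opp x := cls (Mul (Const (-1)) (rep x)).

Lemma cls_add t u : cls (Add t u) = pres_add (cls t) (cls u).
Proof. by apply/clsP/cong_add; apply/cong_sym/clsK. Qed.
Lemma cls_mul t u : cls (Mul t u) = pres_mul (cls t) (cls u).
Proof. by apply/clsP/cong_mul; apply/cong_sym/clsK. Qed.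

Fact pres_addA : associative pres_add.
Proof.
by move=> x y z; rewrite -(repK x) -(repK y) -(repK z) -!cls_add;
  apply/clsP/cong_addA.
Qed.
Fact pres_addC : commutative pres_add.
Proof. by move=> x y; apply/clsP/cong_addC. Qed.
Fact pres_add0 : left_id (cls (Const 0)) pres_add.
Proof. by move=> x; rewrite -(repK x) -cls_add; apply/clsP/cong_add0. Qed.
Fact pres_addN : left_inverse (cls (Const 0)) pres_opp pres_add.
Proof. by move=> x; rewrite -{2}(repK x) -cls_add; apply/clsP/cong_addN. Qed.
HB.instance Definition _ :=
  GRing.isZmodule.Build pres pres_addA pres_addC pres_add0 pres_addN.

Lemma clsD t u : cls (Add t u) = cls t + cls u.
Proof. exact: cls_add. Qed.

Fact pres_mulA : associative pres_mul.
Proof.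
by move=> x y z; rewrite -(repK x) -(repK y) -(repK z) -!cls_mul;
  apply/clsP/cong_mulA.
Qed.
Fact pres_mulC : commutative pres_mul.
Proof. by move=> x y; apply/clsP/cong_mulC. Qed.
Fact pres_mul1 : left_id (cls (Const 1)) pres_mul.
Proof. by move=> x; rewrite -(repK x) -cls_mul; apply/clsP/cong_mul1. Qed.
Fact pres_mulDl : left_distributive pres_mul +%R.
Proof.
move=> x y z; rewrite -(repK x) -(repK y) -(repK z).
rewrite -clsD -!cls_mul -clsD.
exact/clsP/cong_mulDl.
Qed.
HB.instance Definition _ := GRing.Zmodule_isComPzRing.Build pres
  pres_mulA pres_mulC pres_mul1 pres_mulDl.

Lemma clsM t u : cls (Mul t u) = cls t * cls u.
Proof. exact: cls_mul. Qed.

Definition pres_str (c : F) : pres := cls (Const c).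
Fact pres_str_zmod : zmod_morphism pres_str.
Proof.
move=> a b; rewrite /pres_str (proj2 (clsP _ _) (cong_constD a (- b))) clsD.
congr (_ + _); rewrite -mulN1r (proj2 (clsP _ _) (cong_constM _ _)).
by apply/clsP/cong_mul; [apply: cong_refl | apply/cong_sym/clsK].
Qed.
Fact pres_str_monoid : GRing.monoid_morphism pres_str.
Proof. by split=> // a b; rewrite -clsM; apply/clsP/cong_constM. Qed.
HB.instance Definition _ :=
  GRing.isZmodMorphism.Build F pres pres_str pres_str_zmod.
HB.instance Definition _ :=
  GRing.isMonoidMorphism.Build F pres pres_str pres_str_monoid.

Definition pres_algebra : algebra F :=
  @Algebra F pres (pres_str : {rmorphism F -> pres}).

Definition gen (v : T) : pres_algebra := cls (Var v).

Section Eval.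
Context (A : algebra F) (x : T -> A).

Fixpoint eval t : A := match t with
  | Var v => x v
  | Const c => alg_str A c
  | Add t u => eval t + eval u
  | Mul t u => eval t * eval u
  end.

Definition solution : Prop := forall t u, rel t u -> eval t = eval u.

Lemma eval_cong t u : solution -> cong t u -> eval t = eval u.
Proof.
move=> sol; elim=> {t u} //=.
- by move=> t u s _ -> _ ->.
- by move=> t t' u u' _ -> _ ->.
- by move=> t t' u u' _ -> _ ->.
- by move=> *; rewrite addrA.
- by move=> *; rewrite addrC.
- by move=> *; rewrite rmorph0 add0r.
- by move=> *; rewrite rmorphN1 mulN1r addNr rmorph0.
- by move=> *; rewrite mulrA.
- by move=> *; rewrite mulrC.
- by move=> *; rewrite rmorph1 mul1r.
- by move=> *; rewrite mulrDl.
- by move=> *; rewrite rmorphD.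
- by move=> *; rewrite rmorphM.
Qed.

Hypothesis sol : solution.
Definition pres_lift (p : pres_algebra) : A := eval (rep p).
Lemma pres_liftE t : pres_lift (cls t) = eval t.
Proof. exact/eval_cong/clsK. Qed.
Fact pres_lift_zmod : zmod_morphism pres_lift.
Proof.
move=> p q; rewrite -(repK p) -(repK q).
have -> : cls (rep p) - cls (rep q)
    = cls (Add (rep p) (Mul (Const (-1)) (rep q))).
  rewrite clsD; congr (_ + _); apply/clsP/cong_mul; last exact: clsK.
  exact: cong_refl.
by rewrite !pres_liftE /= rmorphN1 mulN1r.
Qed.
Fact pres_lift_monoid : GRing.monoid_morphism pres_lift.
Proof.
split=> [|p q]; first by rewrite pres_liftE /= rmorph1.
by rewrite -(repK p) -(repK q) -clsM !pres_liftE.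
Qed.
HB.instance Definition _ :=
  GRing.isZmodMorphism.Build pres_algebra A pres_lift pres_lift_zmod.
HB.instance Definition _ :=
  GRing.isMonoidMorphism.Build pres_algebra A pres_lift pres_lift_monoid.
Fact pres_lift_str c :
  (pres_lift : {rmorphism pres_algebra -> A}) (alg_str pres_algebra c) = alg_str A c.
Proof. exact: pres_liftE. Qed.
Definition pres_hom : algHom pres_algebra A := AlgHom pres_lift_str.
Lemma pres_hom_gen v : pres_hom (gen v) = x v.
Proof. exact: pres_liftE. Qed.
End Eval.

Lemma hom_eval (A : algebra F) (h : algHom pres_algebra A) t :
  h (cls t) = eval (fun v => h (gen v)) t.
Proof.
elim: t => //= [c|t <- u <-|t <- u <-].
- exact: (algHom_str h c).
- by rewrite clsD rmorphD.
- by rewrite clsM rmorphM.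
Qed.

Lemma hom_solution (A : algebra F) (h : algHom pres_algebra A) :
  solution (fun v => h (gen v)).
Proof.
move=> t u tu; rewrite -!hom_eval; congr (h _).
exact/clsP/cong_rel.
Qed.

Lemma pres_hom_ext (A : algebra F) (h k : algHom pres_algebra A) :
  (forall v, h (gen v) = k (gen v)) -> h = k.
Proof.
move=> /funext hk; apply: algHom_ext => p.
by rewrite -(repK p) !hom_eval hk.
Qed.

Lemma gen_solution : solution gen.
Proof. exact: (@hom_solution _ (algHom_id _)). Qed.

End Presentation.

Lemma eval_sum (F : fieldType) (T I : Type) (A : algebra F) (x : T -> A)
    (r : seq I) (t : I -> term F T) :
  eval x (\big[@Add F T/Const 0]_(i <- r) t i) = \sum_(i <- r) eval x (t i).
Proof. by apply: big_morph => //=; rewrite rmorph0. Qed.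

(** A map out of the presented algebra amounts to a solution of the relations, namely its values on
    the generators, and [coords] identifies points with solutions. The presented algebra therefore
    represents the functor. *)
Lemma affine_presented (F : fieldType) (T : Type)
    (rel : term F T -> term F T -> Prop) (G : groupFunctor F)
    (coords : forall A : algebra F, G A -> T -> A) :
  (forall A (x : G A), solution rel (coords A x)) ->
  (forall A, injective (coords A)) ->
  (forall (A : algebra F) (y : T -> A), solution rel y -> exists x, coords A x = y) ->
  (forall A B (h : algHom A B) (x : G A) v,
     coords B (gmap h x) v = h (coords A x v)) ->
  affine G.
Proof.
move=> sol inj surj nat; constructor.
pose iso A (h : algHom (pres_algebra rel) A) :=
  projT1 (cid (surj A _ (hom_solution h))).
have isoE A h : coords A (iso A h) = fun v => h (gen rel v).
  by rewrite /iso; case: cid.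
apply: (@Representation _ _ (pres_algebra rel) iso) => [A|A B h f].
  exists (fun x => pres_hom (sol A x)) => [h|x].
    by apply: pres_hom_ext => v; rewrite pres_hom_gen isoE.
  by apply: inj; rewrite isoE; apply: funext => v; rewrite pres_hom_gen.
by apply: inj; apply: funext => v; rewrite nat !isoE.
Qed.

(** * Constant schemes *)

Lemma affine_const (F : fieldType) (gT : finGroupType) :
  affine (const_scheme F gT).
Proof.
constructor.
apply: (@Representation _ (const_scheme F gT) (ffun_algebra F gT)
  (fun A h => h)) => // A.
by exists id.
Qed.

Section PointOfIdempotents.
Context (F : fieldType) (gT : finGroupType) (A : algebra F) (e : gT -> A).
Hypothesis e_orth : forall s t, s != t -> e s * e t = 0.
Hypothesis e_sum : \sum_s e s = 1.

Lemma orth_idem s : e s * e s = e s.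
Proof.
rewrite -[RHS]mulr1 -e_sum mulr_sumr (bigD1 s) //= [X in _ + X]big1 ?addr0 //.
by move=> t ts; rewrite e_orth // eq_sym.
Qed.

Definition idem_point_fun (f : ffun_algebra F gT) : A :=
  \sum_s alg_str A ((f : {ffun gT -> F}) s) * e s.
Fact idem_point_zmod : zmod_morphism idem_point_fun.
Proof.
move=> f g; rewrite /idem_point_fun -sumrB; apply: eq_bigr => s _.
by rewrite !ffunE rmorphB mulrBl.
Qed.
Fact idem_point_monoid : GRing.monoid_morphism idem_point_fun.
Proof.
split=> [|f g].
  rewrite /idem_point_fun -[RHS]e_sum; apply: eq_bigr => s _.
  by rewrite ffunE rmorph1 mul1r.
rewrite /idem_point_fun mulr_suml; apply: eq_bigr => s _.
rewrite mulr_sumr (bigD1 s) //= [X in _ + X]big1 ?addr0 => [|t ts].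
  by rewrite mulrACA orth_idem !ffunE rmorphM.
by rewrite mulrACA e_orth ?mulr0 // eq_sym.
Qed.
HB.instance Definition _ := GRing.isZmodMorphism.Build (ffun_algebra F gT) A
  idem_point_fun idem_point_zmod.
HB.instance Definition _ := GRing.isMonoidMorphism.Build (ffun_algebra F gT) A
  idem_point_fun idem_point_monoid.
Fact idem_point_str c : (idem_point_fun : {rmorphism _ -> _})
  (alg_str (ffun_algebra F gT) c) = alg_str A c.
Proof.
rewrite /= /idem_point_fun -[RHS]mulr1 -e_sum mulr_sumr.
by apply: eq_bigr => s _; rewrite ffunE.
Qed.
Definition idem_point : points gT A := AlgHom idem_point_str.

Lemma idem_point_eps s : idem_point (eps F s) = e s.
Proof.
rewrite /= /idem_point_fun (bigD1 s) //= ffunE eqxx rmorph1 mul1r.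
by rewrite big1 ?addr0 // => t ts; rewrite ffunE (negPf ts) rmorph0 mul0r.
Qed.
End PointOfIdempotents.

(** A nonzero difference a - b would be invertible in F and would kill e. *)
Lemma algebra_str_inj (F : fieldType) (A : algebra F) (e : A) (a b : F) :
  e != 0 -> alg_str A a * e = alg_str A b * e -> a = b.
Proof.
move=> e0 abe; apply/eqP; rewrite -subr_eq0; apply: contraNT e0 => ab.
rewrite -[e]mul1r -(rmorph1 (alg_str A)) -(mulVf ab) rmorphM -mulrA.
by rewrite rmorphB mulrBl abe subrr mulr0.
Qed.

(** Multiplying [a f] by the idempotent at s leaves f(s) times that idempotent, which determines
    f(s). *)
Lemma point_injective (F : fieldType) (gT : finGroupType) (A : algebra F)
    (a : points gT A) :
  (forall s, a (eps F s) != 0) -> injective a.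
Proof.
move=> a0 f g afg; apply/ffunP => s; apply: (algebra_str_inj (a0 s)).
have aE h : a h * a (eps F s) = alg_str A ((h : {ffun gT -> F}) s) * a (eps F s).
  rewrite point_sum mulr_suml (bigD1 s) //= [X in _ + X]big1 ?addr0.
    by rewrite -mulrA point_epsM eqxx mul1r.
  by move=> t ts; rewrite -mulrA point_epsM (negPf ts) mul0r mulr0.
by rewrite -!aE afg.
Qed.

(* Any representing algebra of the constant scheme is F^H, by Yoneda, so only
   the values of the idempotents at the universal point matter. *)
Lemma quotient_map_const (F : fieldType) (gT : finGroupType)
    (G : groupFunctor F) (q : groupHom G (const_scheme F gT)) :
  (forall s, exists (A : algebra F) (x : G A),
     (q A x : points gT A) (eps F s) != 0) ->
  quotient_map q.
Proof.
move=> q0 rG rH h hq.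
pose U := rep_iso (algHom_id (rep_alg rG)).
pose qU : points gT (rep_alg rG) := q _ U.
(* The idempotent at s of the universal point cannot vanish, since the map [k x], which takes [U] to
   [x], sends it to a nonzero one. *)
have qU_inj : injective qU.
  apply: point_injective => s; have [A [x]] := q0 s.
  have [k _ kK] := rep_bij rG A; apply: contra => /eqP qUs.
  rewrite -(kK x); have -> : rep_iso (k x) = gmap (k x) U.
    rewrite -rep_nat; congr (rep_iso _); exact: algHom_ext.
  by rewrite ghom_nat /= -/qU qUs rmorph0.
pose u : points gT (rep_alg rH) := rep_iso (algHom_id (rep_alg rH)).
have qUE : qU = algHom_comp h u.
  have hE : algHom_comp h (algHom_id (rep_alg rH)) = h by apply: algHom_ext.
  by rewrite /qU -hq -[in LHS]hE rep_nat.
(* The universal point [u] is itself an algebra map out of the functions on [gT]. The map classified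
   by the identity point is a right inverse of it, which reduces the injectivity of [h] to that of
   [qU]. *)
have [g _ gK] := rep_bij rH (ffun_algebra F gT).
pose id0 : points gT (ffun_algebra F gT) := algHom_id _.
have uK : algHom_comp u (g id0) = algHom_id (rep_alg rH).
  apply: (bij_inj (rep_bij rH _)); rewrite rep_nat gK; exact: algHom_ext.
have uK1 x : u (g id0 x) = x.
  exact: (congr1 (fun k : algHom _ _ => k x) uK).
move=> x y hxy; rewrite -(uK1 x) -(uK1 y); congr (u _); apply: qU_inj.
by rewrite qUE /= !uK1.
Qed.

(** * The idempotents of an automorphism *)

Lemma cinv_eq (R : comPzRingType) (x y : R) : x * y = 1 -> cinv x = y.
Proof.
move=> xy; have /cinvP xV : exists y, x * y = 1 by exists y.
by rewrite -[LHS]mulr1 -xy mulrA [cinv x * x]mulrC xV mul1r.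
Qed.

Lemma rmorph_cinv (R S : comPzRingType) (h : {rmorphism R -> S}) (x : R) :
  (exists y, x * y = 1) -> h (cinv x) = cinv (h x).
Proof.
by move=> /cinvP xV; apply/esym/cinv_eq; rewrite -rmorphM xV rmorph1.
Qed.

(** * Structure constants, and the matrix of an automorphism *)

Section StructureMatrix.
Context (F : fieldType) (E : vectType F) (mul : {bilinear E -> E -> E}).
Context (n : nat) (B : n.-tuple E) (natB : natural_basis mul B).
Local Notation alpha := (struct_mx mul B).

Lemma coord_mul x y k : coord B k (mul x y) =
  \sum_i coord B i x * coord B i y * alpha i k.
Proof.
have [/andP[/eqP sB _] orthB] := natB.
have dec z : z = \sum_i coord B i z *: tnth B i.
  rewrite {1}(@coord_span _ _ _ B z) ?sB ?memvf //.
  by apply: eq_bigr => i _; rewrite (tnth_nth 0).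
rewrite {1}(dec x) {1}(dec y) linear_sumlz raddf_sum; apply: eq_bigr => i _ /=.
rewrite linear_sumr raddf_sum (bigD1 i) //= [X in _ + X]big1 ?addr0 => [|j ji].
  by rewrite linearZl_LR linearZr_LR !linearZ /= !mxE mulrA.
by rewrite linearZl_LR linearZr_LR orthB 1?eq_sym // !scaler0 linear0.
Qed.

Lemma ext_mulE (A : algebra F) (x y : 'rV[A]_n) k :
  ext_mul mul B x y 0 k = \sum_i x 0 i * y 0 i * alg_str A (alpha i k).
Proof.
rewrite mxE; apply: eq_bigr => i _.
rewrite (bigD1 i) //= [X in _ + X]big1 ?addr0 ?mxE // => j ji.
by rewrite natB.2 1?eq_sym // linear0 rmorph0 mulr0.
Qed.

(** Each v_j is a combination of products, and each product is a combination of the squares v_i^2,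
    whose coordinates are the rows of alpha. The resulting coefficients form the left inverse. *)
Lemma struct_mx_invertible : perfect mul -> exists W, W *m alpha = 1%:M.
Proof.
move=> perf; have [/andP[_ fB] _] := natB.
pose s j := projT1 (cid (perf (tnth B j))).
have sE j : tnth B j = \sum_(t <- s j) t.1 *: mul t.2.1 t.2.2.
  by rewrite /s; case: cid.
exists (\matrix_(j, i) \sum_(t <- s j) t.1 * (coord B i t.2.1 * coord B i t.2.2)).
apply/matrixP => j k; rewrite !mxE.
transitivity (coord B k (tnth B j)); last first.
  by rewrite (tnth_nth 0) coord_free // eq_sym.
rewrite [in RHS](sE j) raddf_sum /=.
under eq_bigr do rewrite mxE mulr_suml.
rewrite exchange_big; apply: eq_bigr => t _ /=.
rewrite linearZ /= coord_mul mulr_sumr; apply: eq_bigr => i _.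
by rewrite !mulrA.
Qed.

Lemma struct_mx_cancel (A : algebra F) (y : 'I_n -> A) : perfect mul ->
  (forall l, \sum_k y k * alg_str A (alpha k l) = 0) -> forall k, y k = 0.
Proof.
move=> /struct_mx_invertible[W /mulmx1C WK] y0 k.
transitivity (\sum_j y j * alg_str A ((alpha *m W) j k)).
  rewrite WK (bigD1 k) //= mxE eqxx rmorph1 mulr1 big1 ?addr0 // => j jk.
  by rewrite mxE (negPf jk) rmorph0 mulr0.
transitivity (\sum_l (\sum_j y j * alg_str A (alpha j l)) * alg_str A (W l k)).
  under [RHS]eq_bigr do rewrite mulr_suml.
  rewrite exchange_big; apply: eq_bigr => j _ /=.
  rewrite mxE rmorph_sum mulr_sumr; apply: eq_bigr => l _.
  by rewrite rmorphM mulrA.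
by rewrite big1 // => l _; rewrite y0 mul0r.
Qed.

Section Automorphism.
Context (A : algebra F).
Implicit Types (f g : ext_aut mul B A) (s t u : 'S_n).
Local Notation str := (alg_str A).

Lemma aut_mx_lin1 f : aut_mx f = (lin1_mx f)^T.
Proof. by apply/matrixP => i j; rewrite !mxE. Qed.

Lemma aut_mxM f g : aut_mx (f * g)%g = aut_mx g *m aut_mx f.
Proof.
rewrite !aut_mx_lin1 -trmx_mul; congr trmx; apply/row_matrixP => i.
by rewrite !rowE mulmxA !mul_rV_lin1.
Qed.

Lemma aut_mx_map (C : algebra F) (h : algHom A C) f :
  aut_mx (aut_map h f) = map_mx h (aut_mx f).
Proof.
apply/matrixP => i j.
transitivity (aut_map_fun h f (delta_mx 0 j) 0 i); first by rewrite mxE.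
by rewrite -(map_delta_mx h) aut_mapE !mxE.
Qed.

Lemma aut_mx1 : aut_mx (1%g : ext_aut mul B A) = 1%:M.
Proof. by apply/matrixP => i j; rewrite !mxE /= eq_sym. Qed.

Lemma det_aut_mx_unit f : exists y, \det (aut_mx f) * y = 1.
Proof.
exists (\det (aut_mx f^-1%g)).
by rewrite mulrC -det_mulmx -aut_mxM mulgV aut_mx1 det1.
Qed.

Lemma ext_mul_delta i j : ext_mul mul B (delta_mx 0 i) (delta_mx 0 j) =
  (i == j)%:R *: \sum_k str (alpha i k) *: delta_mx 0 k :> 'rV[A]_n.
Proof.
apply/rowP => k; rewrite ext_mulE (bigD1 i) //= [X in _ + X]big1 => [|l li].
  rewrite addr0 !mxE !eqxx mul1r; congr (_ * _).
  rewrite summxE (bigD1 k) //= big1 => [|l lk]; last first.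
    by rewrite !mxE eq_sym (negPf lk) mulr0.
  by rewrite addr0 !mxE !eqxx mulr1.
by rewrite !mxE (negPf li) mul0r mul0r.
Qed.

(** The coordinates of f(v_i) f(v_j) = f(v_i v_j) = 0 are combinations of the r_ki r_kj with
    coefficients alpha_kl, and alpha is invertible. *)
Lemma aut_mx_orth f k i j : perfect mul -> i != j ->
  aut_mx f k i * aut_mx f k j = 0.
Proof.
move=> perf ij; pose y k := aut_mx f k i * aut_mx f k j.
apply: (@struct_mx_cancel A y perf) => l.
have := ext_autM f (delta_mx 0 i) (delta_mx 0 j).
rewrite ext_mul_delta (negPf ij) scale0r linear0 => /rowP/(_ l).
rewrite ext_mulE [LHS]mxE => E0; rewrite [RHS]E0.
by apply: eq_bigr => k' _; rewrite /y 2![aut_mx f _ _]mxE.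
Qed.

(** The coordinates at v_l of the two sides of f(v_i)^2 = f(v_i^2). *)
Lemma aut_mx_sq f i l :
  \sum_k aut_mx f k i ^+ 2 * str (alpha k l) =
  \sum_j str (alpha i j) * aut_mx f l j.
Proof.
have := ext_autM f (delta_mx 0 i) (delta_mx 0 i).
rewrite ext_mul_delta eqxx scale1r linear_sum => /rowP/(_ l).
rewrite ext_mulE summxE => fii.
transitivity (\sum_k f (delta_mx 0 i) 0 k * f (delta_mx 0 i) 0 k * str (alpha k l)).
  by apply: eq_bigr => k _; rewrite [in LHS]mxE expr2.
rewrite -fii. apply: eq_bigr => j _.
by rewrite linearZ !mxE.
Qed.

Lemma e_coef_fac f s j : exists y, e_coef f s = y * aut_mx f (s j) j.
Proof. by rewrite /e_coef (bigD1 j) //= mulrCA; eexists; rewrite mulrC. Qed.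

(** The product e_s contains the entry of row l in column s^-1(l), which is orthogonal to the other
    entries of that row. Thus f is monomial with permutation s where e_s is 1. *)
Lemma e_coef_kill f s l j : perfect mul -> l != s j ->
  e_coef f s * aut_mx f l j = 0.
Proof.
move=> perf lj; have [y] := e_coef_fac f s ((s^-1)%g l); rewrite permKV => ->.
rewrite -mulrA aut_mx_orth ?mulr0 //; apply: contraNneq lj => <-.
by rewrite permKV.
Qed.

Lemma e_coef_orth f s t : perfect mul -> s != t -> e_coef f s * e_coef f t = 0.
Proof.
move=> perf st; have [j] : exists j, t j != s j.
  apply/existsP; rewrite -negb_forall; apply: contra st => /forallP ts.
  by apply/eqP/permP => j; rewrite (eqP (ts j)).
move=> tsj; have [y ->] := e_coef_fac f t j.
by rewrite mulrCA e_coef_kill ?mulr0.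
Qed.

(** Leibniz expansion of the determinant, applied to the transpose because the permutation acts on
    row indices in [e_coef]. *)
Lemma e_coef_sum f : \sum_s e_coef f s = 1.
Proof.
transitivity (cinv (\det (aut_mx f)) * \det (aut_mx f)^T); last first.
  by rewrite det_tr mulrC cinvP //; apply: det_aut_mx_unit.
rewrite mulr_sumr.
apply: eq_bigr => s _; rewrite /e_coef -mulrA mulrCA; congr (_ * (_ * _)).
by apply: eq_bigr => i _; rewrite [in RHS]mxE.
Qed.

Lemma e_coef_idem f s : perfect mul -> e_coef f s * e_coef f s = e_coef f s.
Proof.
move=> perf; apply: orth_idem (e_coef_sum f) s => s t.
exact: e_coef_orth.
Qed.

(** After multiplication by e_s, each sum in [aut_mx_sq] keeps a single term; this is the binomial
    equation. *)
Lemma e_coef_sq f s i j : perfect mul ->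
  e_coef f s * (aut_mx f (s i) i ^+ 2 * str (alpha (s i) (s j))) =
  e_coef f s * (str (alpha i j) * aut_mx f (s j) j).
Proof.
move=> perf; have := congr1 (fun x => e_coef f s * x) (aut_mx_sq f i (s j)).
rewrite !mulr_sumr (bigD1 (s i)) //= [X in _ + X]big1 => [|k ki]; last first.
  by rewrite expr2 !mulrA e_coef_kill ?mul0r.
rewrite addr0 => ->; rewrite (bigD1 j) //= big1 ?addr0 // => k kj.
by rewrite mulrCA e_coef_kill ?mulr0 // (inj_eq perm_inj) eq_sym.
Qed.

(** Split 1 into the idempotents e_s of f. On the part of e_s the automorphism f is monomial, so the
    entry of f * g at (u i, i) is the entry of g at (u i, s i) times that of f at (s i, i). *)
Lemma e_coefM f g u : perfect mul ->
  e_coef (f * g)%g u = \sum_s e_coef f s * e_coef g (s^-1 * u)%g.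
Proof.
move=> perf; rewrite -[LHS]mul1r -(e_coef_sum f) mulr_suml.
apply: eq_bigr => s _.
have prodE : e_coef f s * \prod_i aut_mx (f * g)%g (u i) i =
    e_coef f s * (\prod_i aut_mx g (u i) (s i) * \prod_i aut_mx f (s i) i).
  rewrite -big_split /=; elim/big_ind2: _ => // [x x' y y' xx' yy'|i _].
    by rewrite mulrA xx' mulrAC yy' -mulrA [y * x]mulrC.
  rewrite aut_mxM mxE mulr_sumr (bigD1 (s i)) //= big1 ?addr0 // => l lsi.
  by rewrite mulrCA e_coef_kill ?mulr0.
have detV : cinv (\det (aut_mx (f * g)%g))
    = cinv (\det (aut_mx f)) * cinv (\det (aut_mx g)).
  apply: cinv_eq; rewrite aut_mxM det_mulmx [X in X * _]mulrC.
  by rewrite mulrACA !cinvP ?mulr1 //; apply: det_aut_mx_unit.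
have signE : (-1) ^+ u = (-1) ^+ s * (-1) ^+ (s^-1 * u)%g :> A.
  by rewrite -signr_addb -odd_permM mulKVg.
have eg : e_coef g (s^-1 * u)%g = (-1) ^+ (s^-1 * u)%g *
    cinv (\det (aut_mx g)) * \prod_i aut_mx g (u i) (s i).
  rewrite /e_coef [X in _ * X = _](reindex_inj (@perm_inj _ s)) /=.
  by congr (_ * _); apply: eq_bigr => i _; rewrite permM permK.
(* The entries of f, with their share of the sign and determinant, assemble into a second copy of
   e_s, which idempotence absorbs. *)
transitivity (e_coef f s * (e_coef f s * e_coef g (s^-1 * u)%g)).
  rewrite {1}/e_coef mulrCA prodE mulrCA; congr (_ * _).
  rewrite eg {1}/e_coef detV signE [X in _ * X = _]mulrC.
  by rewrite [RHS]mulrACA [X in _ = X * _]mulrACA.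
by rewrite mulrA e_coef_idem.
Qed.

Lemma e_coef_map (C : algebra F) (h : algHom A C) f s :
  e_coef (aut_map h f) s = h (e_coef f s).
Proof.
rewrite /e_coef aut_mx_map det_map_mx !rmorphM rmorph_sign.
rewrite rmorph_cinv; last exact: det_aut_mx_unit.
by congr (_ * _); rewrite rmorph_prod; apply: eq_bigr => i _; rewrite mxE.
Qed.

End Automorphism.
End StructureMatrix.

(** * The schemes of the sequence and the map rho *)

(** The generator [inl v] is the value at v and [inr v] its inverse. *)
Inductive diag_rel (F : fieldType) (V : finType) (e : rel V) :
    term F (V + V) -> term F (V + V) -> Prop :=
| DiagRelUnit v : diag_rel e (Mul (Var (inl v)) (Var (inr v))) (Const 1)
| DiagRelEdge v w : e v w ->
    diag_rel e (Var (inl w)) (Mul (Var (inl v)) (Var (inl v))).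

Lemma affine_diag (F : fieldType) (V : finType) (e : rel V) :
  affine (DiagScheme e F).
Proof.
apply: (@affine_presented F (V + V)%type (diag_rel e) (DiagScheme e F)
  (fun A (x : diag e A) v =>
     match v with inl v => x v | inr v => cinv (x v) end)).
- move=> A x t u [v|v w vw] /=.
    by rewrite cinvP ?rmorph1 //; apply: diag_unit.
  by rewrite (diag_edge x vw).
- move=> A x y xy; apply: diag_ext => v.
  exact: (congr1 (fun k => k (inl v)) xy).
- move=> A y sol.
  have yu v : y (inl v) * y (inr v) = 1.
    by rewrite -(rmorph1 (alg_str A)); apply: (sol _ _ (DiagRelUnit F e v)).
  have [u1 u2] : (forall v, exists z, [ffun v => y (inl v)] v * z = 1) /\
      (forall v w, e v w ->
        [ffun v => y (inl v)] w = [ffun v => y (inl v)] v ^+ 2).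
    split=> [v|v w vw]; first by exists (y (inr v)); rewrite ffunE.
    by rewrite !ffunE; apply: (sol _ _ (DiagRelEdge F vw)).
  exists (DiagPoint u1 u2); apply: funext => -[v|v] /=; rewrite ffunE //.
  exact: cinv_eq.
- move=> A C h x [v|v] /=; rewrite ffunE // rmorph_cinv //.
  exact: diag_unit.
Qed.

Section AutomorphismScheme.
Context (F : fieldType) (E : vectType F) (mul : {bilinear E -> E -> E}).
Context (n : nat) (B : n.-tuple E) (natB : natural_basis mul B).
Local Notation alpha := (struct_mx mul B).
Local Notation coordT := ('I_n * 'I_n + 'I_n * 'I_n)%type.

Let X i j : term F coordT := Var (inl (i, j)).
Let Y i j : term F coordT := Var (inr (i, j)).
Let tsum (t : 'I_n -> term F coordT) := \big[@Add F coordT/Const 0]_i t i.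

(** Here [X] is the matrix with the images of the basis as rows, the transpose of [aut_mx], and [Y]
    is its inverse. [AutRelMul] compares the coordinates at v_l of f(v_i) f(v_j) and f(v_i v_j). *)
Inductive aut_rel : term F coordT -> term F coordT -> Prop :=
| AutRelInv i k : aut_rel (tsum (fun j => Mul (X i j) (Y j k))) (Const (i == k)%:R)
| AutRelVni i k : aut_rel (tsum (fun j => Mul (Y i j) (X j k))) (Const (i == k)%:R)
| AutRelMul i j l : aut_rel
    (tsum (fun k => Mul (Mul (X i k) (X j k)) (Const (alpha k l))))
    (tsum (fun k => Mul (Const ((i == j)%:R * alpha i k)) (X k l))).

Section OfMatrices.
Context (A : algebra F) (P Q : 'M[A]_n).
Hypotheses (PQ : P *m Q = 1%:M) (QP : Q *m P = 1%:M).
Hypothesis PM : forall i j l,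
  \sum_k P i k * P j k * alg_str A (alpha k l) =
  \sum_k alg_str A ((i == j)%:R * alpha i k) * P k l.

Fact mulmxr_bij : bijective (mulmxr P : {linear 'rV[A]_n -> 'rV[A]_n}).
Proof.
by exists (mulmxr Q) => x; rewrite /= -mulmxA ?PQ ?QP mulmx1.
Qed.
Fact mulmxr_autM :
  {morph (mulmxr P : {linear 'rV[A]_n -> 'rV[A]_n}) :
    x y / ext_mul mul B x y}.
Proof.
move=> x y; rewrite {1}(row_sum_delta x) {1}(row_sum_delta y).
rewrite [in RHS](row_sum_delta x) [in RHS](row_sum_delta y).
rewrite !linear_sum !ext_mul_suml linear_sum; apply: eq_bigr => i _.
rewrite !ext_mul_sumr linear_sum; apply: eq_bigr => j _.
rewrite !linearZ !ext_mulZl !ext_mulZr !linearZ /=.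
rewrite !scalerA [y 0 j * _]mulrC; congr (_ *: _).
rewrite /= -!rowE; apply/rowP => l.
rewrite ext_mulE // ext_mul_delta // -scalemxAl mulmx_suml.
transitivity (\sum_k P i k * P j k * alg_str A (alpha k l)); last first.
  by apply: eq_bigr => k _; rewrite [row i P _ _]mxE [row j P _ _]mxE.
rewrite PM mxE summxE mulr_sumr; apply: eq_bigr => k _.
rewrite rmorphM rmorph_nat -scalemxAl -rowE.
by rewrite [X in _ * X]mxE [X in _ * (_ * X)]mxE mulrA.
Qed.
Definition aut_of_mx : ext_aut mul B A := ExtAut mulmxr_bij mulmxr_autM.
Lemma aut_of_mx_lin1 : lin1_mx aut_of_mx = P.
Proof. by apply/row_matrixP => i; rewrite !rowE mul_rV_lin1. Qed.
End OfMatrices.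

Lemma lin1_mx_autM (A : algebra F) (f g : ext_aut mul B A) :
  lin1_mx (f * g)%g = lin1_mx f *m lin1_mx g.
Proof. by apply: trmx_inj; rewrite trmx_mul -!aut_mx_lin1 aut_mxM. Qed.

Lemma lin1_mx_aut1 (A : algebra F) : lin1_mx (1%g : ext_aut mul B A) = 1%:M.
Proof. by apply: trmx_inj; rewrite -aut_mx_lin1 aut_mx1 trmx1. Qed.

Lemma lin1_mx_aut_map (A C : algebra F) (h : algHom A C) (f : ext_aut mul B A) :
  lin1_mx (aut_map h f) = map_mx h (lin1_mx f).
Proof. by apply: trmx_inj; rewrite -aut_mx_lin1 aut_mx_map aut_mx_lin1 map_trmx. Qed.

Lemma lin1_mx_aut_inj (A : algebra F) (f g : ext_aut mul B A) :
  lin1_mx f = lin1_mx g -> f = g.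
Proof. by move=> fg; apply: ext_aut_ext => x; rewrite -!mul_rV_lin1 fg. Qed.

Lemma aut_mapV (A C : algebra F) (h : algHom A C) (f : ext_aut mul B A) :
  aut_map h f^-1%g = (aut_map h f)^-1%g.
Proof.
apply/eqP; rewrite -(inj_eq (mulgI (aut_map h f))) mulgV -aut_map_morph mulgV.
apply/eqP/lin1_mx_aut_inj.
by rewrite lin1_mx_aut_map !lin1_mx_aut1 map_mx1.
Qed.

Lemma affine_aut : affine (AutScheme mul B).
Proof.
apply: (@affine_presented F coordT aut_rel (AutScheme mul B)
  (fun A (f : ext_aut mul B A) v => match v with
     | inl ij => lin1_mx f ij.1 ij.2
     | inr ij => lin1_mx f^-1%g ij.1 ij.2 end)).
- move=> A f t u [i k|i k|i j l]; rewrite !eval_sum /=.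
  + transitivity ((lin1_mx f *m lin1_mx f^-1%g) i k); first by rewrite [RHS]mxE.
    by rewrite -lin1_mx_autM mulgV lin1_mx_aut1 mxE rmorph_nat.
  + transitivity ((lin1_mx f^-1%g *m lin1_mx f) i k); first by rewrite [RHS]mxE.
    by rewrite -lin1_mx_autM mulVg lin1_mx_aut1 mxE rmorph_nat.
  + have := congr1 (fun x : 'rV_n => x 0 l)
      (ext_autM f (delta_mx 0 i) (delta_mx 0 j)).
    rewrite ext_mulE // ext_mul_delta // linearZ linear_sum mxE summxE.
    move=> fij.
    transitivity (\sum_k f (delta_mx 0 i) 0 k * f (delta_mx 0 j) 0 k *
        alg_str A (alpha k l)).
      by apply: eq_bigr => k _; rewrite ![lin1_mx f _ _]mxE.
    rewrite -fij mulr_sumr; apply: eq_bigr => k _.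
    by rewrite linearZ mxE rmorphM rmorph_nat mulrA [lin1_mx f _ _]mxE.
- move=> A f g fg; apply: lin1_mx_aut_inj; apply/matrixP => i j.
  exact: (congr1 (fun k => k (inl (i, j))) fg).
- move=> A y sol.
  pose P : 'M[A]_n := \matrix_(i, j) y (inl (i, j)).
  pose Q : 'M[A]_n := \matrix_(i, j) y (inr (i, j)).
  have PQ : P *m Q = 1%:M.
    apply/matrixP => i k; have := sol _ _ (AutRelInv i k).
    rewrite eval_sum /= rmorph_nat !mxE => <-.
    by apply: eq_bigr => j _; rewrite !mxE.
  have QP : Q *m P = 1%:M.
    apply/matrixP => i k; have := sol _ _ (AutRelVni i k).
    rewrite eval_sum /= rmorph_nat !mxE => <-.
    by apply: eq_bigr => j _; rewrite !mxE.
  have PM i j l : \sum_k P i k * P j k * alg_str A (alpha k l) =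
      \sum_k alg_str A ((i == j)%:R * alpha i k) * P k l.
    have := sol _ _ (AutRelMul i j l); rewrite !eval_sum /= => e.
    transitivity (\sum_k y (inl (i, k)) * y (inl (j, k)) * alg_str A (alpha k l)).
      by apply: eq_bigr => k _; rewrite ![P _ _]mxE.
    by rewrite e; apply: eq_bigr => k _; rewrite [P _ _]mxE.
  exists (aut_of_mx PQ QP PM); apply: funext => -[] [i j] /=.
    by rewrite (aut_of_mx_lin1 PQ QP PM) mxE.
  suff -> : lin1_mx (aut_of_mx PQ QP PM)^-1%g = Q by rewrite mxE.
  rewrite -[LHS]mulmx1 -PQ mulmxA -{2}(aut_of_mx_lin1 PQ QP PM) -lin1_mx_autM.
  by rewrite mulVg lin1_mx_aut1 mul1mx.
- move=> A C h f [] [i j]; first by rewrite /= lin1_mx_aut_map mxE.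
  rewrite -[LHS]/(lin1_mx (aut_map h f)^-1%g i j).
  by rewrite -aut_mapV lin1_mx_aut_map mxE.
Qed.

(** * The homomorphism rho and its kernel *)

Section Rho.
Hypothesis perf : perfect mul.
Context (K : {group 'S_n}).
Hypothesis e_out : forall (A : algebra F) (f : ext_aut mul B A) s,
  s \notin K -> e_coef f s = 0.

Lemma e_coef_subg_orth (A : algebra F) (f : ext_aut mul B A) (s t : subg_of K) :
  s != t -> e_coef f (sgval s) * e_coef f (sgval t) = 0.
Proof. by move=> st; rewrite e_coef_orth // (inj_eq val_inj). Qed.

Lemma sum_subg (A : algebra F) (u : 'S_n -> A) :
  (forall s, s \notin K -> u s = 0) -> \sum_(s : subg_of K) u (sgval s) = \sum_s u s.
Proof.
move=> uK; rewrite [RHS](bigID (mem K)) /= [X in _ + X]big1 // addr0.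
rewrite (reindex_onto (@sgval _ K) (subg K)) /=; last by move=> s; apply: subgK.
by apply: eq_bigl => s; rewrite subgP sgvalK eqxx.
Qed.

Lemma e_coef_subg_sum (A : algebra F) (f : ext_aut mul B A) :
  \sum_(s : subg_of K) e_coef f (sgval s) = 1.
Proof. by rewrite sum_subg ?e_coef_sum // => s; apply: e_out. Qed.

(** The group [K] is left open so that one construction yields both the map to the constant scheme
    of Aut(Gamma) and its factor through that of H. *)
Definition rho_fun (A : algebra F) (f : AutScheme mul B A) :
    const_scheme F (subg_of K) A :=
  idem_point (@e_coef_subg_orth A f) (@e_coef_subg_sum A f).

Lemma rho_eps (A : algebra F) (f : ext_aut mul B A) s :
  (rho_fun f : points (subg_of K) A) (eps F s) = e_coef f (sgval s).
Proof. exact: idem_point_eps. Qed.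

Fact rho_morph A : {morph @rho_fun A : x y / (x * y)%g}.
Proof.
move=> f g; apply: point_ext => u; rewrite rho_eps.
(* In the convolution product, only the pairs (s, s^-1 u) contribute to the value at [eps u]. *)
transitivity (\sum_s (rho_fun f : points _ A) (eps F s) *
    (rho_fun g : points _ A) (eps F (s^-1 * u)%g)); last first.
  apply: eq_bigr => s _.
  rewrite (bigD1 (s^-1 * u)%g) //= [X in _ = _ + X]big1 => [|t tn].
    by rewrite ffunE mulKVg eqxx rmorph1 mul1r addr0.
  rewrite ffunE (canF_eq (mulKg s)).
  by rewrite (negPf tn) rmorph0 mul0r.
under [RHS]eq_bigr do rewrite !rho_eps.
rewrite e_coefM // -sum_subg => [//|s sK].
by rewrite e_out ?mul0r.
Qed.

Fact rho_nat A C (h : algHom A C) (f : AutScheme mul B A) :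
  rho_fun (gmap h f) = gmap h (rho_fun f).
Proof.
by apply: point_ext => u; rewrite rho_eps [LHS]e_coef_map /= -rho_eps.
Qed.

Definition rho_hom : groupHom (AutScheme mul B) (const_scheme F (subg_of K)) :=
  GroupHom rho_morph rho_nat.

(** If e_1 = 1 then f is diagonal by [e_coef_kill], its diagonal entries divide 1, and [e_coef_sq]
    gives the edge conditions because alpha_ij is invertible on an edge. Conversely, for a diagonal
    automorphism every e_s with s nontrivial has a zero factor, and the sum forces e_1 = 1. *)
Lemma rho_ker (A : algebra F) (f : ext_aut mul B A) :
  rho_hom A f = 1%g <-> exists y : diag (evol_graph mul B) A, iota_hom natB A y = f.
Proof.
split=> [f1|[p <-]].
  have e1 : e_coef f 1%g = 1.
    rewrite -[1%g]/(sgval (1%g : subg_of K)) -rho_eps.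
    transitivity ((1%g : points (subg_of K) A) (eps F 1%g)).
      by congr ((_ : points _ _) _).
    by rewrite [LHS]cone_eps eqxx.
  have f0 l j : l != j -> aut_mx f l j = 0.
    by move=> lj; rewrite -[LHS]mul1r -e1 e_coef_kill // perm1.
  pose p := [ffun i => aut_mx f i i].
  have pu i : exists y, p i * y = 1.
    have [y ey] := e_coef_fac f 1%g i; exists y.
    by rewrite ffunE mulrC -e1 ey perm1.
  have pe i j : evol_graph mul B i j -> p j = p i ^+ 2.
    rewrite /evol_graph !ffunE => aij.
    have := e_coef_sq natB f 1%g i j perf; rewrite e1 !mul1r !perm1 mulrC.
    move=> /(congr1 (fun x => alg_str A (alpha i j)^-1 * x)).
    by rewrite !mulrA -!rmorphM mulVf // rmorph1 !mul1r.
  exists (DiagPoint pu pe); apply: ext_aut_ext; apply: linear_eq_delta => i.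
  apply/rowP => j; rewrite !mxE /= ffunE.
  have [->|ji] := eqVneq j i; first by rewrite mulr1 mxE.
  by rewrite mulr0 -(f0 j i ji) mxE.
have M s i : aut_mx (iota_aut natB p) (s i) i = p (s i) * (s i == i)%:R.
  by rewrite !mxE.
have e0 s : s != 1%g -> e_coef (iota_aut natB p) s = 0.
  move=> s1; have [i si] : exists i, s i != i.
    apply/existsP; rewrite -negb_forall; apply: contra s1 => /forallP ts.
    by apply/eqP/permP => j; rewrite perm1 (eqP (ts j)).
  by rewrite /e_coef (bigD1 i) //= M (negPf si) mulr0 mul0r mulr0.
apply: point_ext => s; rewrite rho_eps [RHS]cone_eps.
have [->|s1] := eqVneq s 1%g; last first.
  by rewrite e0 // (inj_eq val_inj s 1%g).
rewrite -[RHS](e_coef_sum (iota_aut natB p)) (bigD1 1%g) //= big1 ?addr0 //.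
Qed.

End Rho.

Lemma iota_mono : monomorphism (iota_hom natB).
Proof.
move=> A p q pq; apply: diag_ext => i.
have := congr1 (fun f : ext_aut mul B A => f (delta_mx 0 i) 0 i) pq.
by rewrite /= !mxE !eqxx !mulr1.
Qed.

End AutomorphismScheme.

(** * The subgroup H *)

Section Monomials.
Context (V : finType).

(** Monomials are exponent vectors, so their product is written as a sum and the monomial 1 is 0. *)
Definition mono_var (v : V) : {ffun V -> nat} := [ffun w => (w == v) : nat].

Definition mono_eval (R : comPzRingType) (x : V -> R) (m : {ffun V -> nat}) : R :=
  \prod_v x v ^+ m v.

Lemma mono_evalD (R : comPzRingType) (x : V -> R) m k :
  mono_eval x (m + k) = mono_eval x m * mono_eval x k.
Proof. by rewrite -big_split; apply: eq_bigr => v _; rewrite ffunE exprD. Qed.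

Lemma mono_eval0 (R : comPzRingType) (x : V -> R) : mono_eval x 0 = 1.
Proof. by rewrite /mono_eval big1 // => v _; rewrite ffunE. Qed.

Lemma mono_eval_var (R : comPzRingType) (x : V -> R) v :
  mono_eval x (mono_var v) = x v.
Proof.
rewrite /mono_eval (bigD1 v) //= big1 => [|w wv]; rewrite ffunE.
  by rewrite eqxx mulr1.
by rewrite (negPf wv).
Qed.

(** * Action of polynomials on functions of monomials *)

Section Action.
Context (F : fieldType).
Implicit Types (g h : {ffun V -> nat} -> F) (t u : term F V).

(** Functions of monomials are the linear forms on F[V]; a polynomial t acts on them by the
    transpose of multiplication by t. *)
Fixpoint shift_act t g (m : {ffun V -> nat}) : F := match t with
  | Var v => g (m + mono_var v)
  | Const c => c * g m
  | Add t u => shift_act t g m + shift_act u g m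
  | Mul t u => shift_act t (shift_act u g) m
  end.

Lemma shift_actD t g h :
  shift_act t (fun m => g m + h m) = fun m => shift_act t g m + shift_act t h m.
Proof.
elim: t g h => //= [c|t IHt u IHu|t IHt u IHu] g h; apply: funext => m.
- by rewrite mulrDr.
- by rewrite IHt IHu addrACA.
- by rewrite IHu IHt.
Qed.

Lemma shift_actZ t c g :
  shift_act t (fun m => c * g m) = fun m => c * shift_act t g m.
Proof.
elim: t g => //= [d|t IHt u IHu|t IHt u IHu] g; apply: funext => m.
- by rewrite mulrCA.
- by rewrite IHt IHu mulrDr.
- by rewrite IHu IHt.
Qed.

Lemma shift_act_shift t v g :
  shift_act t (fun m => g (m + v)) = fun m => shift_act t g (m + v).
Proof.
elim: t g => //= [w|t IHt u IHu|t IHt u IHu] g; apply: funext => m.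
- by rewrite addrAC.
- by rewrite IHt IHu.
- by rewrite IHu IHt.
Qed.

Lemma shift_actC t u g :
  shift_act t (shift_act u g) = shift_act u (shift_act t g).
Proof.
elim: u g => [v|c|u IHu w IHw|u IHu w IHw] g /=.
- exact: shift_act_shift.
- exact: shift_actZ.
- by rewrite shift_actD IHu IHw.
- by rewrite -IHw -IHu.
Qed.

(** By induction on the congruence. Stability of [good] serves products, where the left factor acts
    on the result of the right one. *)
Lemma shift_act_cong (rel : term F V -> term F V -> Prop)
    (good : ({ffun V -> nat} -> F) -> Prop) t u :
  (forall s g, good g -> good (shift_act s g)) ->
  (forall t' u' g, rel t' u' -> good g -> shift_act t' g = shift_act u' g) ->
  cong rel t u -> forall g, good g -> shift_act t g = shift_act u g.
Proof.
move=> good_act good_rel; elim=> {t u}.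
- by move=> t u tu g; apply: good_rel.
- by [].
- by move=> t u _ IH g /IH.
- by move=> t u s _ IH _ IH' g gg; rewrite IH ?IH'.
- move=> t t' u u' _ IH _ IH' g gg; apply: funext => m /=.
  by rewrite IH ?IH'.
- move=> t t' u u' _ IH _ IH' g gg; apply: funext => m /=.
  by rewrite IH' // IH //; apply: good_act.
- by move=> t u s g _; apply: funext => m /=; rewrite addrA.
- by move=> t u g _; apply: funext => m /=; rewrite addrC.
- by move=> t g _; apply: funext => m /=; rewrite mul0r add0r.
- by move=> t g _; apply: funext => m /=; rewrite mulN1r addNr mul0r.
- by [].
- by move=> t u g _; apply: funext => m /=; rewrite shift_actC.
- by move=> t g _; apply: funext => m /=; rewrite mul1r.
- by move=> t u s g _; apply: funext => m /=.
- by move=> a b g _; apply: funext => m /=; rewrite mulrDl.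
- by move=> a b g _; apply: funext => m /=; rewrite mulrA.
Qed.
End Action.
End Monomials.

(** * Invariant weights and the group of solvable permutations *)

Section MonomialAutomorphisms.
Context (F : fieldType) (E : vectType F) (mul : {bilinear E -> E -> E}).
Context (n : nat) (B : n.-tuple E) (natB : natural_basis mul B).
Local Notation alpha := (struct_mx mul B).
Local Notation mono := {ffun 'I_n + 'I_n -> nat}.
Local Notation X i := (mono_var (inl i : 'I_n + 'I_n)).
Local Notation Y i := (mono_var (inr i : 'I_n + 'I_n)).

(* The monomial automorphisms v_i |-> x_i v_(s i) over A are the units x_i with
   alpha_(s i)(s j) x_i^2 = alpha_ij x_j; here X i stands for x_i and Y i for
   its inverse. *)
Definition invariant_weight (s : 'S_n) (f : mono -> F) : Prop :=
  (forall m i, f (m + X i + Y i) = f m) /\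
  (forall m i j,
     alpha (s i) (s j) * f (m + X i + X i) = alpha i j * f (m + X j)).

Definition solvable (s : 'S_n) : Prop :=
  exists f, f 0 = 1 /\ invariant_weight s f.

Lemma solvable1 : solvable 1%g.
Proof. by exists (fun=> 1); split=> //; split=> // m i j; rewrite !perm1. Qed.

Definition mono_perm (s : 'S_n) (m : mono) : mono :=
  [ffun v => match v with
             | inl i => m (inl (s^-1%g i))
             | inr i => m (inr (s^-1%g i)) end].

Lemma mono_permD s m k : mono_perm s (m + k) = mono_perm s m + mono_perm s k.
Proof. by apply/ffunP => -[i|i]; rewrite !ffunE. Qed.

Lemma mono_permX s i : mono_perm s (X i) = X (s i).
Proof.
apply/ffunP => -[j|j]; rewrite !ffunE //.
exact: (congr1 nat_of_bool (canF_eq (permKV s) j i)).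
Qed.

Lemma mono_permY s i : mono_perm s (Y i) = Y (s i).
Proof.
apply/ffunP => -[j|j]; rewrite !ffunE //.
exact: (congr1 nat_of_bool (canF_eq (permKV s) j i)).
Qed.

(** Following v_i -> x_i v_(s i) by v_i -> y_i v_(t i) gives the coefficients x_i y_(s i), so the
    weight for t is read after renaming variables by s. The equation of g trades alpha at t(s i),
    t(s j) for alpha at s i, s j, and that of f trades the latter for alpha_ij. *)
Lemma solvableM s t : solvable s -> solvable t -> solvable (s * t)%g.
Proof.
move=> [f [f0 [fU fR]]] [g [g0 [gU gR]]].
exists (fun m => f m * g (mono_perm s m)); split.
  rewrite f0 mul1r -g0; congr (g _).
  by apply/ffunP => -[i|i]; rewrite !ffunE.
split=> [m i|m i j]; rewrite !mono_permD !mono_permX ?mono_permY ?fU ?gU //.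
by rewrite !permM mulrCA gR mulrCA !mulrA fR.
Qed.

Lemma solvable_graph_aut s : solvable s -> s \in graph_aut (evol_graph mul B).
Proof.
move=> [f [f0 [fU fR]]]; rewrite inE; apply/'forall_forallP => i j.
apply/implyP; rewrite /evol_graph => aij.
(* At the monomial Y_j the right side is alpha_ij f(Y_j + X_j) = alpha_ij f(0) = alpha_ij, so
   alpha_(s i)(s j) cannot vanish. *)
apply: contraTneq isT => asij; have := fR (Y j) i j.
rewrite asij mul0r => /esym/eqP; rewrite mulf_eq0 (negPf aij) /=.
by rewrite addrC -[_ + _]add0r addrA fU f0 oner_eq0.
Qed.

Definition sol_set : {set 'S_n} := [set s | `[< solvable s >]].
Fact sol_group_set : group_set sol_set.
Proof.
apply/group_setP; split=> [|s t]; rewrite !inE.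
  exact/asboolP/solvable1.
by move=> /asboolP ss /asboolP tt; apply/asboolP/solvableM.
Qed.
Canonical sol_group : {group 'S_n} := Group sol_group_set.

Lemma e_coef_solvable (A : algebra F) (phi : ext_aut mul B A) s :
  perfect mul -> e_coef phi s != 0 -> solvable s.
Proof.
move=> perf; move eE: (e_coef phi s) => e e0.
(* The cofactor of x_i in e serves as an inverse of x_i after multiplication by e. *)
pose w i := projT1 (cid (e_coef_fac phi s i)).
pose x (v : 'I_n + 'I_n) : A :=
  match v with inl i => aut_mx phi (s i) i | inr i => w i end.
have wx i : w i * aut_mx phi (s i) i = e by rewrite -eE /w; case: cid.
have ewx i : e * (aut_mx phi (s i) i * w i) = e.
  by rewrite [aut_mx _ _ _ * _]mulrC wx -eE e_coef_idem.
(* The scalar is unique because e is nonzero. A monomial whose product with e is no scalar multiple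
   of e gets weight 0. *)
pose f m : F :=
  if pselect (exists c, e * mono_eval x m = alg_str A c * e) is left ex
  then projT1 (cid ex) else 0.
have fE m c : e * mono_eval x m = alg_str A c * e -> f m = c.
  move=> mc; rewrite /f; case: pselect => [ex|[]]; last by exists c.
  case: cid => d /= md; apply: (algebra_str_inj e0); by rewrite -md.
have f_step m k c d a : c != 0 ->
    alg_str A c * (e * mono_eval x m) = alg_str A d * (e * mono_eval x k) ->
    e * mono_eval x k = alg_str A a * e -> c * f m = d * f k.
  move=> c0 mk ka; rewrite (fE _ _ ka) (fE m (c^-1 * (d * a))) ?mulVKf //.
  rewrite !rmorphM -!mulrA -ka -mk [RHS]mulrA -rmorphM mulVf //.
  by rewrite rmorph1 mul1r.
(* With nonzero coefficients, either both monomials give scalar multiples of e or neither does; in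
   the second case both weights are the default 0. *)
have f_rel m k c d : c != 0 -> d != 0 ->
    alg_str A c * (e * mono_eval x m) = alg_str A d * (e * mono_eval x k) ->
    c * f m = d * f k.
  move=> c0 d0 mk.
  have [[a ka]|nk] := pselect (exists a, e * mono_eval x k = alg_str A a * e).
    exact: f_step c0 mk ka.
  have [[a ma]|nm] := pselect (exists a, e * mono_eval x m = alg_str A a * e).
    by apply/esym; apply: f_step d0 (esym mk) ma.
  by rewrite /f; case: pselect => //; case: pselect => // _ _; rewrite !mulr0.
have sq i j : alg_str A (alpha (s i) (s j)) * (e * aut_mx phi (s i) i ^+ 2) =
    alg_str A (alpha i j) * (e * aut_mx phi (s j) j).
  rewrite mulrCA [alg_str A _ * _ ^+ 2]mulrC -eE e_coef_sq //.
  by rewrite [RHS]mulrCA.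
have cancel_x a j : alg_str A a * (e * aut_mx phi (s j) j) = 0 -> a = 0.
  move=> a0; apply: (algebra_str_inj e0).
  by rewrite rmorph0 mul0r -{1}(ewx j) !mulrA -[_ * e * _]mulrA a0 mul0r.
exists f; split.
  by apply: fE; rewrite mono_eval0 mulr1 rmorph1 mul1r.
split=> [m i|m i j].
  rewrite -[LHS]mul1r -[RHS]mul1r; apply: f_rel; rewrite ?oner_eq0 //.
  rewrite rmorph1 !mul1r !mono_evalD !mono_eval_var -[_ * x (inl i) * _]mulrA.
  have exy : e * (x (inl i) * x (inr i)) = e := ewx i.
  by rewrite mulrCA exy mulrC.
(* Since x_i is invertible up to e, the two coefficients vanish together, and then the equation is
   trivial; otherwise [f_rel] applies. *)
have [aij|aij] := eqVneq (alpha i j) 0.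
  suff -> : alpha (s i) (s j) = 0 by rewrite aij !mul0r.
  have := sq i j; rewrite aij rmorph0 mul0r expr2 => sq0.
  apply: (cancel_x _ i).
  rewrite -{1}(ewx i) -!mulrA [w i * _]mulrC.
  by rewrite -[RHS](mul0r (w i)) -sq0 -!mulrA.
have [asij|asij] := eqVneq (alpha (s i) (s j)) 0.
  have := sq i j; rewrite asij rmorph0 mul0r => /esym/cancel_x aij0.
  by rewrite aij0 eqxx in aij.
apply: f_rel => //; rewrite !mono_evalD !mono_eval_var -!mulrA.
rewrite [e * _]mulrCA [LHS]mulrCA [e * (_ * x (inl j))]mulrCA [RHS]mulrCA.
by rewrite -expr2; congr (_ * _).
Qed.

Inductive sol_rel (s : 'S_n) :
    term F ('I_n + 'I_n) -> term F ('I_n + 'I_n) -> Prop :=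
| SolRelUnit i : sol_rel s (Mul (Var (inl i)) (Var (inr i))) (Const 1)
| SolRelSq i j : sol_rel s
    (Mul (Const (alpha (s i) (s j))) (Mul (Var (inl i)) (Var (inl i))))
    (Mul (Const (alpha i j)) (Var (inl j))).

(* Terms act on functions of monomials by shifts; the relations act as
   identities on invariant weights, and one of those is nonzero. *)
Lemma solvable_nonzero s : solvable s -> (1 : pres_algebra (sol_rel s)) != 0.
Proof.
move=> [f [f0 fW]]; apply/eqP => /clsP c10.
have act_good t g :
    invariant_weight s g -> invariant_weight s (shift_act t g).
  elim: t g => [v|c|t IHt u IHu|t IHt u IHu] g gW /=.
  - have [gU gR] := gW.
    have sw m a b : m + a + b + mono_var v = m + mono_var v + a + b.
      by rewrite [LHS]addrAC [m + a + _]addrAC.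
    split=> [m i|m i j]; first by rewrite sw gU.
    by rewrite sw gR [m + _ + X j]addrAC.
  - have [gU gR] := gW; split=> [m i|m i j]; first by rewrite gU.
    by rewrite mulrCA gR mulrCA.
  - have [[tU tR] [uU uR]] := (IHt g gW, IHu g gW).
    split=> [m i|m i j]; first by rewrite tU uU.
    by rewrite !mulrDr tR uR.
  - exact/IHt/IHu.
have act_rel t u g : sol_rel s t u -> invariant_weight s g ->
    shift_act t g = shift_act u g.
  move=> tu [gU gR]; apply: funext => m.
  by case: tu => [i|i j] /=; rewrite ?mul1r ?gU ?gR.
(* If 1 = 0 in the algebra, both constants act alike on f, and at the monomial 0 this reads f(0) =
   0. *)
have := congr1 (fun g : mono -> F => g 0)
  (shift_act_cong act_good act_rel c10 fW).
by rewrite /= f0 mul1r mul0r => /eqP; rewrite oner_eq0.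
Qed.

(** The universal monomial automorphism v_i -> x_i v_(s i) lives over the algebra presented by
    [sol_rel s]. Every e_t with t different from s has a zero factor, so e_s = 1, which is nonzero
    there. *)
Lemma solvable_e_coef s : perfect mul -> solvable s ->
  exists (A : algebra F) (phi : ext_aut mul B A), e_coef phi s != 0.
Proof.
move=> perf /solvable_nonzero; set A := pres_algebra _ => A1.
pose x i : A := gen (sol_rel s) (inl i); pose y i : A := gen (sol_rel s) (inr i).
have xy i : x i * y i = 1.
  by have := gen_solution (SolRelUnit s i); rewrite /= rmorph1.
have xR i j : alg_str A (alpha (s i) (s j)) * (x i * x i) =
    alg_str A (alpha i j) * x j.
  exact: gen_solution (SolRelSq s i j).
pose P : 'M[A]_n := \matrix_(i, j) (x i * (s i == j)%:R).
pose Q : 'M[A]_n := \matrix_(j, i) (y i * (s i == j)%:R).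
have PE i j : P i j = x i * (s i == j)%:R by rewrite mxE.
have PQ : P *m Q = 1%:M.
  apply/matrixP => i k; rewrite !mxE (bigD1 (s i)) //= big1 => [|j ji].
    rewrite PE mxE eqxx mulr1 addr0 (inj_eq perm_inj) eq_sym.
    by case: eqP => [->|_]; rewrite ?mulr0 // mulr1 xy.
  by rewrite PE eq_sym (negPf ji) mulr0 mul0r.
have PM i j l : \sum_k P i k * P j k * alg_str A (alpha k l) =
    \sum_k alg_str A ((i == j)%:R * alpha i k) * P k l.
  have [<-|ij] := eqVneq i j; last first.
    rewrite !big1 // => k _; first by rewrite mul0r rmorph0 mul0r.
    rewrite !PE; have [sik|] := eqVneq (s i) k; last by rewrite mulr0 !mul0r.
    by rewrite -sik (inj_eq perm_inj) eq_sym (negPf ij) !mulr0 mul0r.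
  rewrite (bigD1 (s i)) //= big1 => [|k ki]; last first.
    by rewrite PE eq_sym (negPf ki) mulr0 !mul0r.
  rewrite [RHS](bigD1 ((s^-1)%g l)) //= [Z in _ = _ + Z]big1 => [|k ki].
    by rewrite !addr0 !PE permKV !eqxx !mulr1 mul1r -xR permKV mulrC.
  rewrite PE (canF_eq (permK s)) (negPf ki) !mulr0 //.
pose phi := aut_of_mx natB PQ (mulmx1C PQ) PM.
have phiE i j : aut_mx phi j i = P i j.
  by rewrite aut_mx_lin1 mxE (aut_of_mx_lin1 natB PQ (mulmx1C PQ) PM).
exists A, phi; suff -> : e_coef phi s = 1 by [].
rewrite -[RHS](e_coef_sum phi) (bigD1 s) //= big1 ?addr0 // => t ts.
have [i si] : exists i, s i != t i.
  apply/existsP; rewrite -negb_forall; apply: contra ts => /forallP st.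
  by apply/eqP/permP => j; rewrite (eqP (st j)).
by rewrite /e_coef (bigD1 i) //= phiE PE (negPf si) mulr0 mul0r mulr0.
Qed.

End MonomialAutomorphisms.

(** * The short exact sequence *)

Theorem corollary3p4 (F : fieldType) (E : vectType F)
    (mul : {bilinear E -> E -> E}) (n : nat) (B : n.-tuple E)
    (natB : natural_basis mul B) (perfectE : perfect mul) :
  let G := graph_aut (evol_graph mul B) in
  exists rho : groupHom (AutScheme mul B) (const_scheme F (subg_of G)),
    (forall (R : algebra F) (phi : ext_aut mul B R) (s : subg_of G),
       (rho R phi : points (subg_of G) R) (eps F s) = e_coef phi (sgval s)) /\
    exists (H : {group 'S_n})
      (rhoH : groupHom (AutScheme mul B) (const_scheme F (subg_of H))),
      [/\ H \subset G,
          forall (R : algebra F) (phi : ext_aut mul B R),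
            rho R phi = algHom_comp (rhoH R phi) (restr F H G)
        & short_exact (iota_hom natB) rhoH].
Proof.
move=> G; pose H := sol_group mul B.
have H_out (A : algebra F) (f : ext_aut mul B A) s :
    s \notin H -> e_coef f s = 0.
  rewrite inE => /asboolP sH; apply: contra_notP sH => /eqP.
  exact: e_coef_solvable.
have HG : H \subset G.
  by apply/subsetP => s; rewrite inE => /asboolP; apply: solvable_graph_aut.
have G_out (A : algebra F) (f : ext_aut mul B A) s :
    s \notin G -> e_coef f s = 0.
  by move=> sG; apply: H_out; apply: contra sG; apply: (subsetP HG).
exists (rho_hom natB perfectE G_out); split=> [R phi s|]; first exact: rho_eps.
exists H, (rho_hom natB perfectE H_out); split=> // [R phi|].
  have sgval_inj (K : {group 'S_n}) : injective (@sgval _ K) := val_inj.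
  apply: point_ext => s; rewrite [LHS]rho_eps.
  transitivity ((rho_hom natB perfectE H_out R phi : points (subg_of H) R)
    (restr F H G (eps F s))); last by [].
  (* Restricted to H, the function [eps s] is again a basis function if s lies in H and is 0
     otherwise; in the latter case e_s vanishes as well. *)
  have pullE h : (restr F H G (eps F s) : {ffun subg_of H -> F}) h
      = (sgval h == sgval s)%:R.
    rewrite !ffunE -(inj_eq (sgval_inj _)) subgK //.
    exact: (subsetP HG) (subgP h).
  have [sH|sH] := boolP (sgval s \in H).
    have -> : restr F H G (eps F s) = eps F (subg H (sgval s)).
      by apply/ffunP => h; rewrite pullE ffunE -(inj_eq (sgval_inj _)) subgK.
    by rewrite rho_eps subgK.
  have -> : restr F H G (eps F s) = 0.
    apply/ffunP => h; rewrite pullE ffunE; case: eqP => // hs.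
    by rewrite -hs subgP in sH.
  by rewrite rmorph0 H_out.
split.
- by split; [apply: affine_diag | apply: affine_aut | apply: affine_const].
- exact: iota_mono.
- by move=> A x; apply: rho_ker.
(* Each s in H is realised by an automorphism over some algebra with e_s nonzero, which gives the
   injectivity of the comorphism. *)
- apply: quotient_map_const => s.
  have : sgval s \in H by apply: subgP.
  rewrite inE => /asboolP /(solvable_e_coef natB perfectE)[A [phi phi_s]].
  by exists A, phi; rewrite rho_eps.
Qed.
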